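(* Let $\epsilon>0$ and $\eta=3^{3/2}2^{-1}$. Endow $\mathbf B_\epsilon$ and $\mathbf H$ with the metric induced by the norm $\|(a,b)\|_{\mathcal H}=(\|a\|_{L^2(\mathbb T)}^2+\|b\|_{L^2(\mathbb T)}^2)^{1/2}$. Then the map sending $(a,b)\in\mathbf B_\epsilon$ to the right factor $(a_+,b_+)\in\mathbf H$ of its unique factorization $(a,b)=(a_-,b_-)(a_+,b_+)$ with $(a_-,b_-)\in\mathbf H_0^*$, $(a_+,b_+)\in\mathbf H$, is Lipschitz with constant at most $(2^{5/2}+4)(\eta\epsilon)^{-3/2}$.
   Context: $\mathbb T$ unit circle, $\mathbb D$ open unit disc, $\mathbb D^*=\{\overline z^{-1}:z\in\mathbb D\}\cup\{\infty\}$, $a^*(z)=\overline{a(\overline z^{-1})}$. $H^2(\mathbb D)$: functions in $L^2(\mathbb T)$ with vanishing negative Fourier coefficients; $H^2(\mathbb D^* )$: $f$ with $f^*\in H^2(\mathbb D)$, extended analytically to $\mathbb D^*$ with $f(\infty)=\overline{f^*(0)}$. Inner function: bounded analytic $g$ on $\mathbb D$ with $|g|=1$ a.e. on $\mathbb T$. Pairs multiply as $(a,b)(c,d)=(ac-bd^*,ad+bc^* )$. $\mathbf L$: pairs $(a,b)$ of measurable functions on $\mathbb T$ with $aa^*+bb^*=1$ a.e., $a\in H^2(\mathbb D^* )$, $a(\infty)>0$. $\overline{\mathbf H}$: $(a,b)\in\mathbf L$ with $b\in H^2(\mathbb D)$. $\mathbf H$: $(a,b)\in\overline{\mathbf H}$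 such that any inner $g$ with $a^*g^{-1},bg^{-1}\in H^2(\mathbb D)$ is constant. $\mathbf H_0^*$: $(a,b)\in\mathbf L$ with $(a,b^* )\in\mathbf H$ and $b^*(0)=0$. $\mathbf B$: $(a,b)\in\mathbf L$ with $\inf_{z\in\mathbb D^*}|a(z)|^2>\frac12$; every $(a,b)\in\mathbf B$ has a unique factorization as stated. $\mathbf B_\epsilon$: $(a,b)\in\mathbf B$ with $\inf_{z\in\mathbb D^*}|a(z)|\ge2^{-1/2}+\epsilon$. *)

(* Defs.v *)
From HB Require Import structures.
From mathcomp Require Import all_boot all_order all_algebra.
From mathcomp Require Import all_classical all_reals all_analysis.
From mathcomp Require Import complex.
Import Order.TTheory GRing.Theory Num.Theory.
Local Open Scope ring_scope.
Local Open Scope classical_set_scope.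

Set Implicit Arguments.
Unset Strict Implicit.
Unset Printing Implicit Defensive.

Section Hardy.
Variable R : realType.
Local Notation C := (R[i]).

(* a measurable function on the unit circle T is represented by its
   angular parametrization  theta |-> f(e^{i theta}),  theta in [0, 2 pi[ *)
Definition fn := R -> C.

Definition Tset : set R := `[0, 2 * pi[.
Definition mu := (@lebesgue_measure R).

Definition cmod (z : C) : R := Num.sqrt (complex.Re z ^+ 2 + complex.Im z ^+ 2).

Definition expi (x : R) : C := Complex (cos x) (sin x).

Definition measurable_fn (f : fn) : Prop :=
  measurable_fun Tset (fun t => complex.Re (f t)) /\
  measurable_fun Tset (fun t => complex.Im (f t)).

Definition L2 (f : fn) : Prop :=
  measurable_fn f /\ (\int[mu]_(t in Tset) ((cmod (f t)) ^+ 2)%:E < +oo)%E.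

Definition L2norm (f : fn) : R :=
  Num.sqrt ((2 * pi)^-1 * Rintegral mu Tset (fun t => (cmod (f t)) ^+ 2)).

Definition cmean (f : fn) : C :=
  Complex ((2 * pi)^-1 * Rintegral mu Tset (fun t => complex.Re (f t)))
          ((2 * pi)^-1 * Rintegral mu Tset (fun t => complex.Im (f t))).

Definition fourier (f : fn) (n : int) : C :=
  cmean (fun t => f t * expi (- (n%:~R * t))).

Definition H2D (f : fn) : Prop :=
  L2 f /\ forall n : int, (n < 0)%R -> fourier f n = 0.

(* boundary values of a^*(z) = conj (a (conj z ^-1)); on T, conj z^-1 = z *)
Definition star (f : fn) : fn := fun t => conjc (f t).

Definition H2Dstar (f : fn) : Prop := H2D (star f).

Definition extD (h : fn) (z : C) : C :=
  Complex (limn (fun N : nat => \sum_(0 <= k < N) complex.Re (fourier h k%:Z * z ^+ k)))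
          (limn (fun N : nat => \sum_(0 <= k < N) complex.Im (fourier h k%:Z * z ^+ k))).

(* D^* = {conj z^-1 : z in D} u {oo}; [None] stands for oo *)
Definition Dstar : set (option C) :=
  fun z => match z with None => True | Some z => 1 < cmod z end.

Definition extDstar (a : fn) (z : option C) : C :=
  match z with
  | None => conjc (extD (star a) 0)
  | Some z => conjc (extD (star a) (conjc z)^-1)
  end.

Definition ae_on (P : R -> Prop) : Prop := {ae mu, forall t, Tset t -> P t}.

(* inner function (through its boundary values): bounded analytic on D
   (an element of H^2(D) with |g| = 1 a.e. on T) *)
Definition inner (g : fn) : Prop :=
  H2D g /\ ae_on (fun t => cmod (g t) = 1).

Definition constant_fn (g : fn) : Prop := exists c : C, ae_on (fun t => g t = c).

Definition pair := (fn * fn)%type.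

Definition pmul (p q : pair) : pair :=
  (fun t => p.1 t * q.1 t - p.2 t * star q.2 t,
   fun t => p.1 t * q.2 t + p.2 t * star q.1 t).

Definition pair_ae_eq (p q : pair) : Prop :=
  ae_on (fun t => p.1 t = q.1 t /\ p.2 t = q.2 t).

Definition Lset : set pair := fun p =>
  measurable_fn p.1 /\ measurable_fn p.2 /\
  ae_on (fun t => p.1 t * star p.1 t + p.2 t * star p.2 t = 1) /\
  H2Dstar p.1 /\ 0 < extDstar p.1 None.

Definition Hbar : set pair := fun p => Lset p /\ H2D p.2.

Definition Hset : set pair := fun p =>
  Hbar p /\
  forall g : fn, inner g ->
    H2D (fun t => star p.1 t * (g t)^-1) ->
    H2D (fun t => p.2 t * (g t)^-1) ->
    constant_fn g.

Definition H0star : set pair := fun p =>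
  Lset p /\ Hset (p.1, star p.2) /\ extD (star p.2) 0 = 0.

Definition infDstar (a : fn) : R := inf [set cmod (extDstar a z) | z in Dstar].

Definition infDstar2 (a : fn) : R :=
  inf [set cmod (extDstar a z) ^+ 2 | z in Dstar].

Definition Bset : set pair := fun p => Lset p /\ 2^-1 < infDstar2 p.1.

Definition Beps (eps : R) : set pair := fun p =>
  Bset p /\ (Num.sqrt 2)^-1 + eps <= infDstar p.1.

Definition Hnorm (p : pair) : R := Num.sqrt (L2norm p.1 ^+ 2 + L2norm p.2 ^+ 2).

Definition psub (p q : pair) : pair :=
  (fun t => p.1 t - q.1 t, fun t => p.2 t - q.2 t).

End Hardy.

(* Main.v *)
(* The factor (a_+, b_+), scaled by a_+(oo), solves a linear system whose
   coefficient is r = b / a: both a_+ + r^* b_+ - 1 / a_+(oo) and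
   (r a_+ - b_+)^* lie in H^2(D) and vanish at 0, because 1 / a is bounded
   analytic on D^*.  Testing the difference of two such systems against the
   difference of their solutions, the off-diagonal terms cancel by antisymmetry
   and the right factors differ by at most || r - r' || <= 2 ||(a, b) - (a', b')||.
   Since eta eps <= 1, the constant of the theorem is at least 2.

   Two facts on bounded functions in H^2(D) are needed: the mean is
   multiplicative, and 1 / a^* is in H^2(D).  Both follow from the density of
   trigonometric polynomials in L^2(T).  For the second, radial dilates of
   Fourier partial sums are polynomials without zeros in the closed disc, whose
   inverses are uniform limits of polynomials. *)
Require Import Defs.
From HB Require Import structures.
From mathcomp Require Import all_boot all_order all_algebra.
From mathcomp Require Import all_classical all_reals all_analysis.
From mathcomp Require Import measurable_realfun complex.
From mathcomp Require Import ring lra.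
Import Order.TTheory GRing.Theory Num.Theory.
Import numFieldNormedType.Exports.
Local Open Scope ring_scope.
Local Open Scope classical_set_scope.

Set Implicit Arguments.
Unset Strict Implicit.
Unset Printing Implicit Defensive.

(** * Modulus and mean values *)

Section Modulus.
Variable R : realType.
Local Notation C := (R[i]).
Implicit Types (x y z : C) (r : R).

(** Scaling by a_+(oo) gives the first right-hand side of every such system the same mean 1, so the
    differences of two systems have mean 0 and pair to zero with the differences of the solutions.
    The scaling is undone by an identity for unit vectors p, p' and x, y > 0: |x p - y p'|^2 = (x -
    y)^2 + x y |p - p'|^2. The energy estimate is available with the factor x^2 and with y^2, and
    the smaller of these is at most x y. Since |a|^2 + |b|^2 = 1 on T, all functions at hand are
    bounded, so products cause no integrability problem. The obstacle is the passage from the disc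
    to T: the lower bound on |a| is assumed off T, and the extension is tied to the boundary
    function only through Fourier coefficients. Polynomials live on both sides and carry the bound
    across. *)

Lemma cmodE z : cmod z = Normc.normc z. Proof. by case: z. Qed.

Lemma cmodM x y : cmod (x * y) = cmod x * cmod y.
Proof. by rewrite !cmodE Normc.normcM. Qed.

Lemma cmodD x y : cmod (x + y) <= cmod x + cmod y.
Proof. by rewrite !cmodE; exact: le_normcD. Qed.

Lemma cmodN x : cmod (- x) = cmod x.
Proof. by rewrite !cmodE; exact: normcN. Qed.

Lemma cmodBC x y : cmod (x - y) = cmod (y - x).
Proof. by rewrite -cmodN opprB. Qed.

Lemma cmodV x : cmod x^-1 = (cmod x)^-1.
Proof. by rewrite !cmodE Normc.normcV. Qed.

Lemma cmod0 : cmod (0 : C) = 0. Proof. by rewrite cmodE Normc.normc0. Qed.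

Lemma cmod1 : cmod (1 : C) = 1. Proof. by rewrite cmodE Normc.normc1. Qed.

Lemma cmodX x n : cmod (x ^+ n) = cmod x ^+ n.
Proof. by elim: n => [|n IHn]; rewrite ?expr0 ?cmod1// !exprS cmodM IHn. Qed.

Lemma cmod_eq0 x : (cmod x == 0) = (x == 0).
Proof.
apply/eqP/eqP => [|->]; last exact: cmod0.
by rewrite cmodE => /Normc.eq0_normc.
Qed.

Lemma cmod_ge0 x : 0 <= cmod x. Proof. exact: sqrtr_ge0. Qed.

Lemma cmod_conj x : cmod (conjc x) = cmod x.
Proof. by case: x => a b; rewrite /cmod /= sqrrN. Qed.

Lemma sqr_cmod x : cmod x ^+ 2 = complex.Re x ^+ 2 + complex.Im x ^+ 2.
Proof. by rewrite sqr_sqrtr// addr_ge0// sqr_ge0. Qed.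

Lemma mulcJ x : x * conjc x = (cmod x ^+ 2)%:C%C.
Proof.
by rewrite sqr_cmod; case: x => a b; simpc => /=; congr Complex; ring.
Qed.

Lemma cmod_real r : cmod (r%:C%C) = `|r|.
Proof. by rewrite /cmod/= expr0n/= addr0 sqrtr_sqr. Qed.

Lemma Re_le_cmod x : `|complex.Re x| <= cmod x.
Proof. by rewrite -sqrtr_sqr ler_wsqrtr// lerDl sqr_ge0. Qed.

Lemma Im_le_cmod x : `|complex.Im x| <= cmod x.
Proof. by rewrite -sqrtr_sqr ler_wsqrtr// lerDr sqr_ge0. Qed.

Lemma cmod_le_ReIm x : cmod x <= `|complex.Re x| + `|complex.Im x|.
Proof.
rewrite -(@ler_pXn2r _ 2%N)// ?nnegrE ?addr_ge0 ?cmod_ge0//.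
rewrite sqr_cmod sqrrD !real_normK ?num_real// addrAC lerDl.
by rewrite mulrn_wge0// mulr_ge0.
Qed.

Lemma cmodB_ge x y : cmod x - cmod y <= cmod (x - y).
Proof. by rewrite lerBlDr (le_trans _ (cmodD _ _))// subrK. Qed.

Lemma ReD x y : complex.Re (x + y) = complex.Re x + complex.Re y.
Proof. by case: x; case: y. Qed.

Lemma ImD x y : complex.Im (x + y) = complex.Im x + complex.Im y.
Proof. by case: x; case: y. Qed.

Lemma ReM x y : complex.Re (x * y) =
  complex.Re x * complex.Re y - complex.Im x * complex.Im y.
Proof. by case: x; case: y. Qed.

Lemma ImM x y : complex.Im (x * y) =
  complex.Re x * complex.Im y + complex.Im x * complex.Re y.
Proof. by case: x; case: y. Qed.

Lemma cmod_expi r : cmod (expi r) = 1.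
Proof. by rewrite /cmod/= cos2Dsin2 sqrtr1. Qed.

Lemma expiD r (s : R) : expi (r + s) = expi r * expi s.
Proof. by rewrite /expi cosD sinD; simpc => /=; congr Complex; rewrite addrC. Qed.

Lemma expi0 : expi (0 : R) = 1.
Proof. by rewrite /expi cos0 sin0. Qed.

Lemma expiN r : expi (- r) = conjc (expi r).
Proof. by rewrite /expi cosN sinN. Qed.

Lemma expiX r n : expi r ^+ n = expi (n%:R * r).
Proof.
elim: n => [|n IHn]; first by rewrite mul0r expi0.
by rewrite exprS IHn -expiD -[n.+1]add1n natrD mulrDl mul1r.
Qed.

End Modulus.

(** * Means and mean squares of essentially bounded functions *)

Section Mean.
Variable R : realType.
Local Notation C := (R[i]).
Local Notation T := (@Tset R).
Local Notation mu := (@lebesgue_measure R).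

Lemma ae_filter_lebesgue : Filter (almost_everywhere (@Defs.mu R)).
Proof. exact: (ae_filter_ringOfSetsType mu). Qed.

Lemma ae_onS (P Q : R -> Prop) : (forall t, T t -> P t -> Q t) ->
  ae_on P -> ae_on Q.
Proof.
move=> PQ; apply: (@filterS _ _ ae_filter_lebesgue) => t + Tt => /(_ Tt).
exact: PQ.
Qed.

Lemma ae_onS2 (P1 P2 Q : R -> Prop) : (forall t, T t -> P1 t -> P2 t -> Q t) ->
  ae_on P1 -> ae_on P2 -> ae_on Q.
Proof.
move=> PQ; apply: (@filterS2 _ _ ae_filter_lebesgue) => t + + Tt.
by move=> /(_ Tt) h /(_ Tt); exact: PQ.
Qed.

Lemma ae_on_all (P : R -> Prop) : (forall t, T t -> P t) -> ae_on P.
Proof. by move=> h; apply: (aeW mu). Qed.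

Lemma measurable_T : measurable T. Proof. exact: measurable_itv. Qed.
Hint Resolve measurable_T : core.

Lemma mu_T : mu T = (2 * pi)%:E.
Proof.
rewrite /Tset lebesgue_measure_itv/= lte_fin mulr_gt0 ?pi_gt0//.
by rewrite oppr0 adde0.
Qed.

(* Essentially bounded measurable functions on [T]. *)
Definition rbd (f : R -> R) :=
  measurable_fun T f /\ exists M, ae_on (fun t => `|f t| <= M).

Definition rmean (f : R -> R) := (2 * pi)^-1 * Rintegral mu T f.

Let pi2_gt0 : 0 < (2 * pi : R). Proof. by rewrite mulr_gt0 ?pi_gt0. Qed.

Lemma rbd_integrable f : rbd f -> mu.-integrable T (EFin \o f).
Proof.
move=> [mf [M fM]]; apply/integrableP; split; first exact/measurable_EFinP.
apply: (@le_lt_trans _ _ (\int[mu]_(t in T) (`|M|%:E))%E); last first.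
  by rewrite integral_cst//= -[ltLHS]/(_ * mu T)%E mu_T -EFinM ltry.
apply: ae_ge0_le_integral => //.
- by apply/measurable_EFinP; exact: measurableT_comp.
- apply: (@ae_onS _ (fun t => (`|(f t)%:E| <= `|M|%:E)%E) _ fM) => t _ h.
  by rewrite lee_fin (le_trans h)// ler_norm.
Qed.

Lemma rmeanD f g : rbd f -> rbd g ->
  rmean (fun t => f t + g t) = rmean f + rmean g.
Proof.
move=> bf bg.
by rewrite /rmean RintegralD ?mulrDr//; exact: rbd_integrable.
Qed.

Lemma rmeanB f g : rbd f -> rbd g ->
  rmean (fun t => f t - g t) = rmean f - rmean g.
Proof.
move=> bf bg.
by rewrite /rmean RintegralB ?mulrBr//; exact: rbd_integrable.
Qed.

Lemma rmeanZ k f : rbd f -> rmean (fun t => k * f t) = k * rmean f.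
Proof.
move=> bf; rewrite /rmean RintegralZl// 1?mulrCA//.
exact: rbd_integrable.
Qed.

Lemma rmean_cst k : rmean (fun=> k) = k.
Proof.
rewrite /rmean Rintegral_cst// [fine _](_ : _ = 2 * pi); last exact: (congr1 fine mu_T).
by rewrite mulrCA mulVf ?mulr1// gt_eqF.
Qed.

Lemma rmean_ae f g : measurable_fun T f -> measurable_fun T g ->
  ae_on (fun t => f t = g t) -> rmean f = rmean g.
Proof.
move=> bf bg fg; congr (_ * fine _).
apply: ae_eq_integral => //; try exact/measurable_EFinP.
by apply: (@ae_onS _ (fun t => (f t)%:E = (g t)%:E) _ fg) => t _ ->.
Qed.

Lemma rbdD f g : rbd f -> rbd g -> rbd (fun t => f t + g t).
Proof.
move=> [mf [M fM]] [mg [N gN]]; split; first exact: measurable_funD.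
exists (M + N); apply: ae_onS2 fM gN => t _ h k.
by rewrite (le_trans (ler_normD _ _))// lerD.
Qed.

Lemma rbdM f g : rbd f -> rbd g -> rbd (fun t => f t * g t).
Proof.
move=> [mf [M fM]] [mg [N gN]]; split; first exact: measurable_funM.
exists (M * N); apply: ae_onS2 fM gN => t _ h k.
by rewrite normrM ler_pM.
Qed.

Lemma rbd_cst k : rbd (fun=> k).
Proof. by split=> //; exists `|k|; exact: ae_on_all. Qed.

Lemma rbdN f : rbd f -> rbd (fun t => - f t).
Proof.
move=> [mf [M fM]]; split; first exact: measurableT_comp.
by exists M; apply: ae_onS fM => t _; rewrite normrN.
Qed.

Lemma rbdB f g : rbd f -> rbd g -> rbd (fun t => f t - g t).
Proof. by move=> bf bg; apply: rbdD => //; exact: rbdN. Qed.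

Lemma rbd_norm f : rbd f -> rbd (fun t => `|f t|).
Proof.
move=> [mf [M fM]]; split; first exact: measurableT_comp.
by exists M; apply: ae_onS fM => t _; rewrite normr_id.
Qed.

Lemma rmean_ge0 f : rbd f -> ae_on (fun t => 0 <= f t) -> 0 <= rmean f.
Proof.
move=> bf f0; have -> : rmean f = rmean (fun t => `|f t|).
  apply: rmean_ae; [exact: bf.1|exact: (rbd_norm bf).1|].
  by apply: ae_onS f0 => t _ /ger0_norm.
by apply: mulr_ge0; [rewrite invr_ge0 ltW|apply: Rintegral_ge0].
Qed.

Lemma rmean_le f g : rbd f -> rbd g -> ae_on (fun t => f t <= g t) ->
  rmean f <= rmean g.
Proof.
move=> bf bg fg; rewrite -subr_ge0 -rmeanB//; apply: rmean_ge0; first exact: rbdB.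
by apply: ae_onS fg => t _; rewrite subr_ge0.
Qed.

Lemma rmean_norm f : rbd f -> `|rmean f| <= rmean (fun t => `|f t|).
Proof.
move=> bf; rewrite ler_norml -mulN1r -rmeanZ; last exact: rbd_norm.
apply/andP; split; apply: rmean_le => //; try exact: rbd_norm.
- by apply: rbdM; [exact: rbd_cst|exact: rbd_norm].
- by apply: ae_on_all => t _; rewrite mulN1r lerNl -normrN ler_norm.
- by apply: ae_on_all => t _; rewrite ler_norm.
Qed.

Definition Bd (f : fn R) :=
  measurable_fn f /\ exists M, ae_on (fun t => cmod (f t) <= M).

Implicit Types f g h : fn R.

Lemma Bd_Re f : Bd f -> rbd (fun t => complex.Re (f t)).
Proof.
move=> [[mf _] [M fM]]; split=> //; exists M; apply: ae_onS fM => t _.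
exact/le_trans/Re_le_cmod.
Qed.

Lemma Bd_Im f : Bd f -> rbd (fun t => complex.Im (f t)).
Proof.
move=> [[_ mf] [M fM]]; split=> //; exists M; apply: ae_onS fM => t _.
exact/le_trans/Im_le_cmod.
Qed.

Lemma ReIm_Bd f : rbd (fun t => complex.Re (f t)) ->
  rbd (fun t => complex.Im (f t)) -> Bd f.
Proof.
move=> [mf [M fM]] [mg [N gN]]; split=> //; exists (M + N).
apply: ae_onS2 fM gN => t _ h k.
by rewrite (le_trans (cmod_le_ReIm _))// lerD.
Qed.

Lemma BdD f g : Bd f -> Bd g -> Bd (fun t => f t + g t).
Proof.
move=> bf bg; apply: ReIm_Bd.
- under eq_fun do rewrite ReD; by apply: rbdD; exact: Bd_Re.
- under eq_fun do rewrite ImD; by apply: rbdD; exact: Bd_Im.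
Qed.

Lemma BdM f g : Bd f -> Bd g -> Bd (fun t => f t * g t).
Proof.
move=> bf bg; have := (Bd_Re bf, Bd_Re bg, Bd_Im bf, Bd_Im bg).
move=> [[[rf rg] imf] img]; apply: ReIm_Bd.
- by under eq_fun do rewrite ReM; apply: rbdB; exact: rbdM.
- by under eq_fun do rewrite ImM; apply: rbdD; exact: rbdM.
Qed.

Lemma Bd_cst (c : C) : Bd (fun=> c).
Proof. by apply: ReIm_Bd; exact: rbd_cst. Qed.

Lemma BdN f : Bd f -> Bd (fun t => - f t).
Proof.
move=> bf; rewrite [X in Bd X](_ : _ = (fun t => (- 1) * f t)).
  by apply: BdM => //; exact: Bd_cst.
by apply/funext => t; rewrite mulN1r.
Qed.

Lemma BdB f g : Bd f -> Bd g -> Bd (fun t => f t - g t).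
Proof. by move=> bf bg; apply: BdD => //; exact: BdN. Qed.

Lemma Bd_conj f : Bd f -> Bd (star f).
Proof.
move=> bf; apply: ReIm_Bd.
- rewrite [X in rbd X](_ : _ = (fun t => complex.Re (f t))); first exact: Bd_Re.
  by apply/funext => t; rewrite /star; case: (f t).
- rewrite [X in rbd X](_ : _ = (fun t => - complex.Im (f t))).
    exact/rbdN/Bd_Im.
  by apply/funext => t; rewrite /star; case: (f t).
Qed.

Lemma measurable_cmod f : measurable_fn f -> measurable_fun T (fun t => cmod (f t)).
Proof.
move=> [mf1 mf2]; rewrite /cmod; apply: measurableT_comp.
  by apply: continuous_measurable_fun; exact: sqrt_continuous.
by apply: measurable_funD; exact: measurable_funX.
Qed.

Lemma Bd_cmod f : Bd f -> rbd (fun t => cmod (f t)).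
Proof.
move=> [mf [M fM]]; split; first exact: measurable_cmod.
by exists M; apply: ae_onS fM => t _; rewrite ger0_norm// cmod_ge0.
Qed.

Lemma Bd_expi (k : R) : Bd (fun t => expi (k * t)).
Proof.
have mk : measurable_fun T ( *%R k) by exact: measurable_funM.
split; last by exists 1; apply: ae_on_all => t _; rewrite cmod_expi.
split=> /=.
- apply: (measurableT_comp _ mk).
  by apply: continuous_measurable_fun; exact: continuous_cos.
- apply: (measurableT_comp _ mk).
  by apply: continuous_measurable_fun; exact: continuous_sin.
Qed.

Lemma cmeanE f : cmean f = (rmean (fun t => complex.Re (f t)) +i*
  rmean (fun t => complex.Im (f t)))%C.
Proof. by []. Qed.

Lemma cmeanD f g : Bd f -> Bd g ->
  cmean (fun t => f t + g t) = cmean f + cmean g.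
Proof.
move=> bf bg; rewrite !cmeanE; simpc => /=; congr Complex.
- rewrite -rmeanD; [|exact: Bd_Re|exact: Bd_Re].
  by congr rmean; apply/funext => t; rewrite ReD.
- rewrite -rmeanD; [|exact: Bd_Im|exact: Bd_Im].
  by congr rmean; apply/funext => t; rewrite ImD.
Qed.

Lemma cmeanZ (c : C) f : Bd f -> cmean (fun t => c * f t) = c * cmean f.
Proof.
move=> bf; have bM k (g : R -> R) : rbd g -> rbd (fun t => k * g t).
  by move=> bg; apply: rbdM => //; exact: rbd_cst.
have [br bi] := (Bd_Re bf, Bd_Im bf).
case: c => a b; rewrite !cmeanE; simpc => /=; congr Complex.
- rewrite -!rmeanZ// -rmeanB; [|exact: bM|exact: bM].
  by congr rmean; apply/funext => t; rewrite ReM.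
- rewrite -!rmeanZ// -rmeanD; [|exact: bM|exact: bM].
  by congr rmean; apply/funext => t; rewrite ImM.
Qed.

Lemma cmeanB f g : Bd f -> Bd g ->
  cmean (fun t => f t - g t) = cmean f - cmean g.
Proof.
move=> bf bg; rewrite cmeanD//; last exact: BdN.
congr (_ + _); rewrite -mulN1r -cmeanZ//.
by congr cmean; apply/funext => t; rewrite mulN1r.
Qed.

Lemma cmean_cst (c : C) : cmean (fun=> c) = c.
Proof. by rewrite cmeanE !rmean_cst; case: c. Qed.

Lemma cmean_ae f g : measurable_fn f -> measurable_fn g ->
  ae_on (fun t => f t = g t) -> cmean f = cmean g.
Proof.
move=> [mf1 mf2] [mg1 mg2] fg; rewrite !cmeanE; congr Complex.
- by apply: rmean_ae => //; apply: ae_onS fg => t _ ->.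
- by apply: rmean_ae => //; apply: ae_onS fg => t _ ->.
Qed.

Lemma cmean_conj f : Bd f -> cmean (star f) = conjc (cmean f).
Proof.
move=> bf; rewrite !cmeanE /=; congr Complex.
  by congr rmean; apply/funext => t; rewrite /star; case: (f t).
rewrite -mulN1r -rmeanZ; last exact: Bd_Im.
by congr rmean; apply/funext => t; rewrite /star; case: (f t) => a b; rewrite mulN1r.
Qed.

Lemma cmean_sum (I : Type) (s : seq I) (F : I -> fn R) :
  (forall i, Bd (F i)) ->
  cmean (fun t => \sum_(i <- s) F i t) = \sum_(i <- s) cmean (F i).
Proof.
move=> bF; suff [] : Bd (fun t => \sum_(i <- s) F i t) /\
    cmean (fun t => \sum_(i <- s) F i t) = \sum_(i <- s) cmean (F i) by [].
elim: s => [|i s [IH1 IH2]].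
  rewrite big_nil; under eq_fun do rewrite big_nil.
  by split; [exact: Bd_cst|exact: cmean_cst].
rewrite big_cons; under eq_fun do rewrite big_cons.
by split; [exact: BdD|rewrite cmeanD// IH2].
Qed.

Lemma Re_cmean_le f : Bd f -> `|complex.Re (cmean f)| <= rmean (fun t => cmod (f t)).
Proof.
move=> bf; rewrite cmeanE /=; apply: (le_trans (rmean_norm _)); first exact: Bd_Re.
apply: rmean_le; [exact/rbd_norm/Bd_Re|exact: Bd_cmod|].
by apply: ae_on_all => t _; exact: Re_le_cmod.
Qed.

Lemma Im_cmean_le f : Bd f -> `|complex.Im (cmean f)| <= rmean (fun t => cmod (f t)).
Proof.
move=> bf; rewrite cmeanE /=; apply: (le_trans (rmean_norm _)); first exact: Bd_Im.
apply: rmean_le; [exact/rbd_norm/Bd_Im|exact: Bd_cmod|].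
by apply: ae_on_all => t _; exact: Im_le_cmod.
Qed.

(** The factor 2 comes from estimating real and imaginary parts separately, which avoids rotating
    the mean onto the real axis. *)
Lemma cmod_cmean_le f : Bd f -> cmod (cmean f) <= 2 * rmean (fun t => cmod (f t)).
Proof.
move=> bf; apply: (le_trans (cmod_le_ReIm _)).
have [h1 h2] := (Re_cmean_le bf, Im_cmean_le bf); lra.
Qed.

(* The square of [L2norm]. *)
Definition sqn f := rmean (fun t => cmod (f t) ^+ 2).

Lemma Bd_sqr f : Bd f -> rbd (fun t => cmod (f t) ^+ 2).
Proof. by move=> /Bd_cmod bf; exact: (rbdM bf bf). Qed.

Lemma sqn_ge0 f : 0 <= sqn f.
Proof.
apply: mulr_ge0; first by rewrite invr_ge0 ltW.
by apply: Rintegral_ge0 => t _; rewrite sqr_ge0.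
Qed.

Lemma sqn_ae f g : measurable_fn f -> measurable_fn g ->
  ae_on (fun t => f t = g t) -> sqn f = sqn g.
Proof.
move=> mf mg fg; apply: rmean_ae; last by apply: ae_onS fg => t _ ->.
- by apply: measurable_funX; exact: measurable_cmod.
- by apply: measurable_funX; exact: measurable_cmod.
Qed.

Lemma L2normE f : L2norm f = Num.sqrt (sqn f). Proof. by []. Qed.

Lemma Bd_L2 f : Bd f -> L2 f.
Proof.
move=> bf; split; first exact: bf.1.
have /integrableP[_] := rbd_integrable (Bd_sqr bf).
by under eq_integral do rewrite /= ger0_norm ?sqr_ge0//.
Qed.

(** Stands in for the triangle inequality in L^2 without square roots: pointwise, (x + y)^2 <= 2 x^2
    + 2 y^2. *)
Lemma sqnD f g : Bd f -> Bd g ->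
  sqn (fun t => f t + g t) <= 2 * sqn f + 2 * sqn g.
Proof.
move=> bf bg; have [bf2 bg2] := (Bd_sqr bf, Bd_sqr bg).
have b2 (h : R -> R) : rbd h -> rbd (fun t => 2 * h t).
  by move=> bh; apply: rbdM => //; exact: rbd_cst.
rewrite /sqn -!rmeanZ// -rmeanD; [|exact: b2|exact: b2].
apply: rmean_le; [exact/Bd_sqr/BdD|by apply: rbdD; exact: b2|].
apply: ae_on_all => t _; have := cmodD (f t) (g t).
have := (cmod_ge0 (f t), cmod_ge0 (g t), cmod_ge0 (f t + g t)).
set x := cmod _; set y := cmod (g t); set z := cmod (_ + _).
move=> [[x0 y0] z0] zxy; apply: (@le_trans _ _ ((x + y) ^+ 2)).
  by rewrite ler_pXn2r// nnegrE addr_ge0.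
by have := sqr_ge0 (x - y); nra.
Qed.

(* From |x| <= (|x|^2 / d + d) / 2. *)
Lemma cmean_small M d f g : Bd f -> Bd g -> 0 <= M -> 0 < d ->
  ae_on (fun t => cmod (g t) <= M) -> sqn f <= d ^+ 2 ->
  cmod (cmean (fun t => f t * g t)) <= 2 * (M * d).
Proof.
move=> bf bg M0 d0 gM fd; apply: (le_trans (cmod_cmean_le _)); first exact: BdM.
rewrite ler_wpM2l//.
apply: (@le_trans _ _ (rmean (fun t => M / (2 * d) * cmod (f t) ^+ 2 + M * d / 2))).
  apply: rmean_le; first exact/Bd_cmod/BdM.
    apply: rbdD; last exact: rbd_cst.
    by apply: rbdM; [exact: rbd_cst|exact: Bd_sqr].
  apply: ae_onS gM => t _ gt; rewrite cmodM.
  have -> : M / (2 * d) * cmod (f t) ^+ 2 + M * d / 2 =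
      M * ((cmod (f t) - d) ^+ 2 / (2 * d)) + cmod (f t) * M.
    by field; rewrite gt_eqF.
  rewrite -[leLHS]add0r; apply: lerD; last by rewrite ler_wpM2l ?cmod_ge0.
  by rewrite mulr_ge0// divr_ge0 ?sqr_ge0// mulr_ge0// ltW.
rewrite rmeanD; [|by apply: rbdM; [exact: rbd_cst|exact: Bd_sqr]|exact: rbd_cst].
rewrite rmeanZ; last exact: Bd_sqr.
rewrite rmean_cst -[rmean _]/(sqn f).
apply: (@le_trans _ _ (M / (2 * d) * d ^+ 2 + M * d / 2)).
  by rewrite lerD2r ler_wpM2l// divr_ge0// mulr_ge0// ltW.
by rewrite le_eqVlt; apply/orP; left; apply/eqP; field; rewrite gt_eqF.
Qed.

End Mean.
#[global] Hint Resolve measurable_T : core.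

(** * Density of trigonometric polynomials *)

Section Density.
Variable R : realType.
Local Notation C := (R[i]).
Local Notation T := (@Tset R).
Local Notation mu := (@lebesgue_measure R).
Implicit Types f g h : fn R.

(** A Laurent polynomial, encoded as an ordinary polynomial in e^{it} shifted down by [N]
    frequencies, so that sums and products reduce to those of [{poly C}]. *)
Definition trig g := exists N (P : {poly C}),
  g = fun t => expi (- (N%:R * t)) * P.[expi t].

Lemma trigD f g : trig f -> trig g -> trig (fun t => f t + g t).
Proof.
move=> [N [P ->]] [M [Q ->]]; exists (N + M)%N, (P * 'X^M + Q * 'X^N).
apply/funext => t; rewrite hornerD !hornerM !hornerXn !expiX natrD !mulrDl opprD.
rewrite expiD.
have eK k : expi (- (k%:R * t)) * expi (k%:R * t) = 1 :> C.
  by rewrite -expiD addNr expi0.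
transitivity (expi (- (N%:R * t)) * P.[expi t] *
    (expi (- (M%:R * t)) * expi (M%:R * t)) +
  expi (- (M%:R * t)) * Q.[expi t] *
    (expi (- (N%:R * t)) * expi (N%:R * t))); first by rewrite !eK !mulr1.
ring.
Qed.

Lemma trigM f g : trig f -> trig g -> trig (fun t => f t * g t).
Proof.
move=> [N [P ->]] [M [Q ->]]; exists (N + M)%N, (P * Q).
by apply/funext => t; rewrite hornerM natrD !mulrDl opprD expiD; ring.
Qed.

Lemma trig_cst c : trig (fun=> c).
Proof.
exists 0%N, c%:P; apply/funext => t.
by rewrite hornerC mul0r oppr0 expi0 mul1r.
Qed.

Lemma trig_expi : trig (fun t => expi t).
Proof.
exists 0%N, 'X; apply/funext => t.
by rewrite hornerX mul0r oppr0 expi0 mul1r.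
Qed.

Lemma trig_expiN : trig (fun t => expi (- t)).
Proof. by exists 1%N, 1; apply/funext => t; rewrite hornerC mul1r mulr1. Qed.

Lemma poly_expi_bounded (P : {poly C}) : exists2 M, 0 <= M &
  forall t : R, cmod P.[expi t] <= M.
Proof.
elim/poly_ind: P => [|P c [M M0 PM]].
  by exists 0 => // t; rewrite horner0 cmod0.
exists (M + cmod c); first by rewrite addr_ge0 ?cmod_ge0.
move=> t; rewrite hornerD hornerM hornerX hornerC.
by rewrite (le_trans (cmodD _ _))// lerD2r cmodM cmod_expi mulr1.
Qed.

Lemma Bd_poly_expi (P : {poly C}) : Bd (fun t : R => P.[expi t]).
Proof.
elim/poly_ind: P => [|P c IH]; under eq_fun do rewrite hornerE.
  exact: Bd_cst.
apply: BdD; last by under eq_fun do rewrite hornerC; exact: Bd_cst.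
under eq_fun do rewrite hornerM hornerX; apply: BdM => //.
by have := @Bd_expi R 1; under eq_fun do rewrite mul1r.
Qed.

Lemma trig_Bd g : trig g -> Bd g.
Proof.
move=> [N [P ->]]; apply: BdM; last exact: Bd_poly_expi.
by have := @Bd_expi R (- N%:R); under eq_fun do rewrite mulNr.
Qed.

Lemma trig_bounded g : trig g -> exists2 M, 0 <= M & forall t, cmod (g t) <= M.
Proof.
move=> [N [P ->]]; have [M M0 PM] := poly_expi_bounded P.
by exists M => // t; rewrite cmodM cmod_expi mul1r.
Qed.

(* The closure of the trigonometric polynomials in L^2(T), among bounded
   functions; an algebra closed under bounded pointwise limits. *)
Definition tapp f := Bd f /\ forall d : R, 0 < d -> exists2 g, trig g &
  sqn (fun t => f t - g t) <= d.

Lemma sqn0 : sqn (fun=> 0 : C) = 0.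
Proof. by rewrite /sqn; under eq_fun do rewrite cmod0 expr0n/=; rewrite rmean_cst. Qed.

Lemma sqnM_le M f g : 0 <= M -> Bd f -> Bd g -> ae_on (fun t => cmod (f t) <= M) ->
  sqn (fun t => f t * g t) <= M ^+ 2 * sqn g.
Proof.
move=> M0 bf bg fM; rewrite /sqn -rmeanZ; last exact: Bd_sqr.
apply: rmean_le; first exact/Bd_sqr/BdM.
  by apply: rbdM; [exact: rbd_cst|exact: Bd_sqr].
apply: ae_onS fM => t _ h; rewrite cmodM exprMn ler_wpM2r ?sqr_ge0//.
by rewrite ler_pXn2r// nnegrE ?cmod_ge0.
Qed.

Lemma trig_tapp g : trig g -> tapp g.
Proof.
move=> tg; split; first exact: trig_Bd.
move=> d d0; exists g => //; under [X in sqn X]eq_fun do rewrite subrr.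
by rewrite sqn0 ltW.
Qed.

Lemma tapp_appr f : Bd f ->
  (forall d : R, 0 < d -> exists2 g, tapp g & sqn (fun t => f t - g t) <= d) ->
  tapp f.
Proof.
move=> bf fa; split => // d d0; have d4 : 0 < d / 4 by rewrite divr_gt0.
have [g [bg ga] fg] := fa _ d4; have [h th gh] := ga _ d4.
exists h => //; have bh := trig_Bd th.
have -> : (fun t => f t - h t) = (fun t => (f t - g t) + (g t - h t)).
  by apply/funext => t; rewrite addrA subrK.
apply: (le_trans (sqnD (BdB bf bg) (BdB bg bh))); lra.
Qed.

Lemma tappD f g : tapp f -> tapp g -> tapp (fun t => f t + g t).
Proof.
move=> [bf fa] [bg ga]; split; first exact: BdD.
move=> d d0; have d4 : 0 < d / 4 by rewrite divr_gt0.
have [[f' tf ff'] [g' tg gg']] := (fa _ d4, ga _ d4).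
exists (fun t => f' t + g' t); first exact: trigD.
have -> : (fun t => f t + g t - (f' t + g' t)) =
    (fun t => (f t - f' t) + (g t - g' t)).
  by apply/funext => t; ring.
have [bf' bg'] := (trig_Bd tf, trig_Bd tg).
apply: (le_trans (sqnD (BdB bf bf') (BdB bg bg'))); lra.
Qed.

(** Turns a bound [M] that may vanish into an admissible tolerance [d / (M + 1)]. *)
Lemma mulr_div_le (M d : R) : 0 <= M -> 0 < d -> M * (d / (M + 1)) <= d.
Proof.
by move=> M0 d0; rewrite mulrA ler_pdivrMr; lra.
Qed.

Lemma trig_tappM f g : trig f -> tapp g -> tapp (fun t => f t * g t).
Proof.
move=> tf [bg ga]; have bf := trig_Bd tf; split; first exact: BdM.
have [M M0 fM] := trig_bounded tf; move=> d d0.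
have [|h th gh] := ga (d / (M ^+ 2 + 1)).
  by rewrite divr_gt0// ltr_wpDl// sqr_ge0.
exists (fun t => f t * h t); first exact: trigM.
have -> : (fun t => f t * g t - f t * h t) = (fun t => f t * (g t - h t)).
  by apply/funext => t; rewrite mulrBr.
apply: (le_trans (sqnM_le M0 bf (BdB bg (trig_Bd th)) (ae_on_all _))) => //.
by apply: (le_trans _ (mulr_div_le (sqr_ge0 M) d0)); rewrite ler_wpM2l ?sqr_ge0.
Qed.

(** Mean-square approximants of both factors need not be uniformly bounded. So only [g] is replaced,
    by a polynomial [h], at a cost controlled by the essential bound of [f]; then [f * h] falls
    under [trig_tappM]. *)
Lemma tappM f g : tapp f -> tapp g -> tapp (fun t => f t * g t).
Proof.
move=> tf [bg ga]; have bf := tf.1; apply: tapp_appr; first exact: BdM.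
move=> d d0; have [_ [M fM]] := bf.
have [|h th gh] := ga (d / (`|M| ^+ 2 + 1)).
  by rewrite divr_gt0// ltr_wpDl// sqr_ge0.
exists (fun t => f t * h t).
  by under eq_fun do rewrite mulrC; exact: trig_tappM.
have -> : (fun t => f t * g t - f t * h t) = (fun t => f t * (g t - h t)).
  by apply/funext => t; rewrite mulrBr.
apply: (@le_trans _ _ (`|M| ^+ 2 * sqn (fun t => g t - h t))).
  apply: sqnM_le => //; first exact: (BdB bg (trig_Bd th)).
  by apply: ae_onS fM => t _ /le_trans; apply; exact: ler_norm.
apply: (le_trans _ (mulr_div_le (sqr_ge0 `|M|) d0)).
by rewrite ler_wpM2l ?sqr_ge0.
Qed.

Definition rapp (f : R -> R) := tapp (fun t => (f t)%:C%C).

Lemma rappD (f g : R -> R) : rapp f -> rapp g -> rapp (fun t => f t + g t).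
Proof.
move=> rf rg; rewrite /rapp; under eq_fun do rewrite rmorphD; exact: tappD.
Qed.

Lemma rappM (f g : R -> R) : rapp f -> rapp g -> rapp (fun t => f t * g t).
Proof.
move=> rf rg; rewrite /rapp; under eq_fun do rewrite rmorphM; exact: tappM.
Qed.

Lemma rapp_cst (r : R) : rapp (fun=> r).
Proof. exact/trig_tapp/trig_cst. Qed.

Lemma rappB (f g : R -> R) : rapp f -> rapp g -> rapp (fun t => f t - g t).
Proof.
move=> rf rg; rewrite (_ : (fun t => _) = (fun t => f t + (-1) * g t)).
  by apply: rappD => //; apply: rappM => //; exact: rapp_cst.
by apply/funext => t; rewrite mulN1r.
Qed.

Lemma rapp_rbd (f : R -> R) : rapp f -> rbd f.
Proof. by move=> -[/Bd_Re]. Qed.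

Lemma rbd_Bd (f : R -> R) : rbd f -> Bd (fun t => (f t)%:C%C).
Proof. by move=> bf; apply: ReIm_Bd => //=; exact: rbd_cst. Qed.

Lemma rapp_cos : rapp cos.
Proof.
rewrite /rapp (_ : (fun t => _) = (fun t => 2^-1%:C%C * (expi t + expi (- t)))).
  apply/trig_tapp/trigM; first exact: trig_cst.
  by apply: trigD; [exact: trig_expi|exact: trig_expiN].
apply/funext => t; rewrite /expi cosN sinN; simpc => /=.
by congr Complex; field.
Qed.

Lemma rapp_sin : rapp sin.
Proof.
rewrite /rapp (_ : (fun t => _) = (fun t => (0 -i* 2^-1)%C * (expi t - expi (- t)))).
  apply/trig_tapp/trigM; first exact: trig_cst.
  rewrite (_ : (fun t => _) = (fun t => expi t + (-1) * expi (- t))).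
    apply: trigD; first exact: trig_expi.
    by apply: trigM; [exact: trig_cst|exact: trig_expiN].
  by apply/funext => t; rewrite mulN1r.
apply/funext => t; rewrite /expi cosN sinN; simpc => /=.
by congr Complex; field.
Qed.

(** Dominated convergence for [(f - fs n)^2], with the constant [(2 * M)^2] as majorant. This is the
    step that leads from continuous functions to discontinuous ones. *)
Lemma rapp_lim (fs : nat -> R -> R) (f : R -> R) (M : R) :
  (forall n, rapp (fs n)) -> (forall n t, T t -> `|fs n t| <= M) ->
  (forall t, T t -> (fs ^~ t : nat -> R) @ \oo --> f t) -> rapp f.
Proof.
move=> fa fM ff.
have mf : measurable_fun T f.
  by apply: (measurable_fun_cvg (h := fs)) => // n; have [] := rapp_rbd (fa n).
have fM' t : T t -> `|f t| <= M.
  move=> Tt; have cf : (fun n => `|fs n t|) @ \oo --> `|f t|.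
    by apply: cvg_norm; exact: ff.
  rewrite -(cvg_lim _ cf)//; apply: limr_le; first by apply/cvg_ex; eexists; exact: cf.
  by apply: nearW => n; exact: fM.
have bf : rbd f by split=> //; exists M; exact: ae_on_all.
apply: tapp_appr; first exact: rbd_Bd.
pose h n t := ((f t - fs n t) ^+ 2)%:E.
have bh n : rbd (fun t => (f t - fs n t) ^+ 2).
  have bb := rbdB bf (rapp_rbd (fa n)); exact: (rbdM bb bb).
have [] := @dominated_convergence _ _ R mu T (@measurable_T R) h (cst 0%E) 
  (fun=> ((2 * M) ^+ 2)%:E).
- by move=> n; apply/measurable_EFinP; have [] := bh n.
- by [].
- apply: (aeW mu) => t Tt; rewrite /h; apply/cvg_EFin; first exact: nearW.
  rewrite (_ : _ \o _ = (fun n => (f t - fs n t) ^+ 2)); last by apply/funext.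
  rewrite [X in _ --> X](_ : _ = ((f t - f t) ^+ 2)); last first.
    by rewrite /= subrr expr0n.
  have cB : (fun n => f t - fs n t) @ \oo --> f t - f t.
    by apply: cvgB; [exact: cvg_cst|exact: ff].
  exact: (cvgM cB cB).
- exact: (rbd_integrable (rbd_cst _)).
- apply: (aeW mu) => t n Tt; rewrite /h /= lee_fin ger0_norm ?sqr_ge0//.
  rewrite -real_normK ?num_real// ler_pXn2r ?nnegrE//.
    by rewrite (le_trans (ler_normB _ _))// mulr_natl mulr2n lerD// ?fM'// fM.
  by rewrite mulr_ge0// (le_trans _ (fM' _ Tt)).
move=> _ _; rewrite integral0 => hc d d0.
move/fine_cvgP: hc => [_ /cvgr_lt/(_ (2 * pi * d))].
have pd : 0 < 2 * pi * d by rewrite !mulr_gt0 ?pi_gt0.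
move=> /(_ pd) [N _ /(_ N (leqnn N)) /= hN].
exists (fun t => (fs N t)%:C%C); first exact: fa.
rewrite /sqn; under [X in rmean X]eq_fun do
  rewrite -rmorphB cmod_real real_normK ?num_real//.
by rewrite /rmean ler_pdivrMl ?mulr_gt0 ?pi_gt0// ltW.
Qed.

(* Its iterates converge to the sign function on [-1, 1]. *)
Definition smooth_step (x : R) : R := (3 * x - x ^+ 3) / 2.

(** The distance to 1 is multiplied by (1 - y)(2 + y)/2 = 1 - y/2 - y^2/2 at each step. As the
    iterates increase from [x], this factor is at most 1 - x/2. *)
Lemma iter_smooth_step_gt0 (x : R) n : 0 < x -> x <= 1 ->
  [/\ x <= iter n smooth_step x, iter n smooth_step x <= 1 &
      1 - iter n smooth_step x <= (1 - x / 2) ^+ n].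
Proof.
move=> x0 x1; elim: n => [|n [IH1 IH2 IH3]] /=.
  by split=> //; rewrite expr0; lra.
set y := iter n _ x in IH1 IH2 IH3 *; rewrite /smooth_step.
have y0 : 0 < y := lt_le_trans x0 IH1.
have e1 : (3 * y - y ^+ 3) / 2 = y + y * (1 - y) * (1 + y) / 2 by field.
have e2 : 1 - (3 * y - y ^+ 3) / 2 = (1 - y) * ((1 - y) * (2 + y) / 2) by field.
have p1 : 0 <= (1 - y) * (2 + y) / 2 by rewrite divr_ge0// mulr_ge0; lra.
split.
- rewrite e1; have : 0 <= y * (1 - y) * (1 + y) / 2.
    by rewrite divr_ge0// !mulr_ge0; lra.
  lra.
- rewrite -subr_ge0 e2 mulr_ge0; lra.
- rewrite e2 exprSr ler_pM//; first lra.
  have : 0 <= y ^+ 2 by exact: sqr_ge0.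
  have -> : (1 - y) * (2 + y) / 2 = 1 - y / 2 - y ^+ 2 / 2 by field.
  lra.
Qed.

Lemma iter_smooth_stepN (x : R) n :
  iter n smooth_step (- x) = - iter n smooth_step x.
Proof. by elim: n => //= n ->; rewrite /smooth_step; field. Qed.

Lemma iter_smooth_step0 n : iter n smooth_step 0 = 0.
Proof. by elim: n => //= n ->; rewrite /smooth_step expr0n/= mulr0 subr0 mul0r. Qed.

Lemma iter_smooth_step_cvg_gt0 (x : R) : 0 < x -> x <= 1 ->
  iter n smooth_step x @[n --> \oo] --> (1 : R).
Proof.
move=> x0 x1; have c0 : (fun n => 1 - (1 - x / 2) ^+ n) @ \oo --> (1 - 0 : R).
  by apply: cvgB; [exact: cvg_cst|apply: cvg_expr; rewrite ger0_norm; lra].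
rewrite subr0 in c0.
apply: (@squeeze_cvgr _ _ _ _ (fun n => 1 - (1 - x / 2) ^+ n) (fun=> 1)) => //;
  last exact: cvg_cst.
apply: nearW => n; have [_ -> h] := iter_smooth_step_gt0 n x0 x1.
by rewrite andbT lerBlDr -lerBlDl.
Qed.

Lemma iter_smooth_step_cvg (x : R) : `|x| <= 1 ->
  iter n smooth_step x @[n --> \oo] --> Num.sg x.
Proof.
move=> x1; have [x0|x0|->] := ltrgt0P x.
- rewrite gtr0_sg//; apply: iter_smooth_step_cvg_gt0 => //.
  by rewrite -(gtr0_norm x0).
- rewrite ltr0_sg// -[x]opprK; under eq_fun do rewrite iter_smooth_stepN.
  apply: cvgN; apply: iter_smooth_step_cvg_gt0; first lra.
  by rewrite -(ltr0_norm x0).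
- rewrite sgr0; under eq_fun do rewrite iter_smooth_step0; exact: cvg_cst.
Qed.

Lemma iter_smooth_step_le1 (x : R) n : `|x| <= 1 -> `|iter n smooth_step x| <= 1.
Proof.
move=> x1; have [x0|x0|->] := ltrgt0P x.
- have [|h1 h2 _] := iter_smooth_step_gt0 n x0; first by rewrite -(gtr0_norm x0).
  by rewrite ger0_norm//; lra.
- rewrite -[x]opprK iter_smooth_stepN normrN.
  have [||h1 h2 _] := @iter_smooth_step_gt0 (- x) n; first lra.
    by rewrite -(ltr0_norm x0).
  by rewrite ger0_norm//; lra.
- by rewrite iter_smooth_step0 normr0.
Qed.

(** Each iterate of [smooth_step] at [f] is a polynomial in [f], hence stays in the algebra, and the
    iterates are bounded by 1. *)
Lemma rapp_sg (f : R -> R) : rapp f -> (forall t, T t -> `|f t| <= 1) ->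
  rapp (fun t => Num.sg (f t)).
Proof.
move=> rf f1; apply: (@rapp_lim (fun n t => iter n smooth_step (f t)) _ 1).
- elim=> [//|n IH] /=; rewrite /smooth_step.
  under [X in rapp X]eq_fun do rewrite !exprS expr0 mulr1.
  apply: rappM; last exact: rapp_cst.
  apply: rappB; first by apply: rappM => //; exact: rapp_cst.
  by do 2 apply: rappM => //.
- by move=> n t Tt; apply: iter_smooth_step_le1; exact: f1.
- by move=> t Tt; apply: iter_smooth_step_cvg; exact: f1.
Qed.

(** * Indicators of Borel sets *)

Definition iapp (A : set R) := rapp (\1_A).

Lemma rapp_ext (f g : R -> R) : (forall t, T t -> f t = g t) -> rapp f -> rapp g.
Proof.
move=> fg rf; have [mf [M fM]] := rapp_rbd rf.
have bg : rbd g.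
  split; last by exists M; apply: ae_onS fM => t Tt; rewrite fg.
  by apply: eq_measurable_fun mf => t; rewrite inE => /fg.
apply: tapp_appr; first exact: rbd_Bd.
move=> d d0; exists (fun t => (f t)%:C%C) => //.
rewrite (@sqn_ae _ _ (fun=> 0)) ?sqn0 ?ltW//.
- exact: (BdB (rbd_Bd bg) (rbd_Bd (rapp_rbd rf))).1.
- by apply: ae_on_all => t Tt; rewrite fg// subrr.
Qed.

Lemma iapp_ext (A B : set R) : (forall t, T t -> A t <-> B t) -> iapp A -> iapp B.
Proof.
move=> AB; apply: rapp_ext => t Tt; rewrite !indicE; congr ((nat_of_bool _)%:R).
by apply/idP/idP; rewrite !inE => /AB; apply.
Qed.

Lemma iapp_gt0 (f : R -> R) : rapp f -> (forall t, T t -> `|f t| <= 1) ->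
  iapp [set t | 0 < f t].
Proof.
move=> rf f1; have rs := rapp_sg rf f1.
(* For s in {-1, 0, 1}, (s + s^2)/2 is 1 if s = 1 and 0 otherwise. *)
apply: (@rapp_ext (fun t => (Num.sg (f t) + Num.sg (f t) * Num.sg (f t)) * 2^-1)).
  move=> t Tt; rewrite indicE; have [h|h|h] := ltrgt0P (f t).
  - by rewrite mem_set//= gtr0_sg// mulr1; field.
  - by rewrite memNset/= ?ltr0_sg// ?mulrNN ?mulr1 ?addNr ?mul0r//; lra.
  - by rewrite memNset/= ?h ?sgr0 ?mulr0 ?addr0 ?mul0r//; lra.
by apply: rappM; [apply: rappD => //; exact: rappM|exact: rapp_cst].
Qed.

Lemma iappC (A : set R) : iapp A -> iapp (~` A).
Proof.
move=> iA; rewrite /iapp.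
apply: (@rapp_ext (fun t => 1 - \1_A t)); last by apply: rappB => //; exact: rapp_cst.
move=> t _; rewrite !indicE in_setC; case: (t \in A) => /=; first by rewrite subrr.
by rewrite subr0.
Qed.

Lemma iappI (A B : set R) : iapp A -> iapp B -> iapp (A `&` B).
Proof.
move=> iA iB; rewrite /iapp; apply: (rapp_ext _ (rappM iA iB)) => t _.
by rewrite !indicE in_setI; case: (t \in A); case: (t \in B);
  rewrite /= ?mulr1 ?mulr0.
Qed.

Lemma iapp_set0 : iapp set0.
Proof.
apply: (rapp_ext _ (rapp_cst 0)) => t _.
by rewrite indicE in_set0.
Qed.

(** The complement of the union has as indicator the pointwise limit of the finite products of the
    [1 - \1_(A k)], which are eventually constant at every point. *)
Lemma iapp_bigcup (A : (set R)^nat) : (forall n, iapp (A n)) ->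
  iapp (\bigcup_k A k).
Proof.
move=> iA; rewrite -[X in iapp X]setCK; apply: iappC.
apply: (@rapp_lim (fun n t => \prod_(k < n) (1 - \1_(A k) t)) _ 1).
- elim=> [|n IH]; first by under eq_fun do rewrite big_ord0; exact: rapp_cst.
  under eq_fun do rewrite big_ord_recr/=; apply: rappM => //.
  by apply: rappB; [exact: rapp_cst|exact: iA].
- move=> n t _; rewrite normr_prod; apply: Num.Theory.prodr_ile1 => k _.
  by rewrite normr_ge0 indicE/=; case: (_ \in _); rewrite ?subrr ?subr0 ?normr0 ?normr1.
- move=> t _; rewrite indicE in_setC; have [|] := boolP (t \in _).
    rewrite inE => -[k _ Akt]; apply: cvg_near_cst.
    exists k.+1 => // n /= kn; rewrite (bigD1 (Ordinal kn))//=.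
    by rewrite indicE mem_set// subrr mul0r.
  rewrite notin_setE => nA; rewrite /=; apply: cvg_near_cst; apply: nearW => n.
  rewrite big1// => k _; rewrite indicE memNset ?subr0// => Akt.
  by apply: nA; exists k.
Qed.

Lemma cos_sin_Bpi (t : R) : cos (t - pi) = - cos t /\ sin (t - pi) = - sin t.
Proof. by rewrite cosB sinB cospi sinpi !mulr0 !mulrN1 addr0 subr0. Qed.

(** Within T the ray is an arc, and signs of sin and cos describe it: sin < 0 selects the lower half
    circle, and cos is monotone on each half. For 0 <= x <= pi the arc is the union of {sin t < 0}
    and {cos t < cos x}; for pi < x < 2 pi it is the intersection of {sin t < 0} and {cos t > cos
    x}. Other rays contain T or miss it. *)
Lemma iapp_ray (x : R) : iapp `]x, +oo[.
Proof.
have iU : iapp setT by rewrite -setC0; exact/iappC/iapp_set0.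
have T2 t : T t -> 0 <= t < 2 * pi by rewrite /Tset/= in_itv.
have pi0 := pi_gt0 R.
(* The factor 1/2 keeps differences of cosines in [-1, 1], as [iapp_gt0] requires. *)
have halfcos t y : T t -> `|(cos t - cos y) * 2^-1 : R| <= 1.
  have [h1 h2] := (@cos_le1 R t, @cos_geN1 R t).
  have [h3 h4] := (@cos_le1 R y, @cos_geN1 R y).
  by rewrite ler_norml => _; apply/andP; split; lra.
have rcosB y : rapp (fun t => (cos t - cos y) * 2^-1).
  apply: rappM; last exact: rapp_cst.
  by apply: rappB; [exact: rapp_cos|exact: rapp_cst].
have icos y : iapp [set t | 0 < (cos t - cos y) * 2^-1].
  by apply: iapp_gt0 => // t; exact: halfcos.
have rN (f : R -> R) : rapp f -> rapp (fun t => - f t).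
  move=> rf; apply: (rapp_ext _ (rappB (rapp_cst 0) rf)) => t _.
  by rewrite sub0r.
have icosN y : iapp [set t | 0 < - ((cos t - cos y) * 2^-1)].
  by apply: iapp_gt0; [exact: rN|move=> t Tt; rewrite normrN; exact: halfcos].
have isinN : iapp [set t | 0 < - sin t].
  apply: iapp_gt0; first exact/rN/rapp_sin.
  by move=> t _; rewrite normrN sin_max.
have sin_lt0 t : T t -> (0 < - sin t) = (pi < t).
  move=> /T2 /andP[t0 t2]; have [tpi|tpi] := leP t pi.
    by apply/negbTE; rewrite -leNgt oppr_le0 sin_ge0_pi// t0.
  by rewrite -(cos_sin_Bpi t).2 sin_gt0_pi//; lra.
have [x0|x0] := ltP x 0.
  apply: (iapp_ext _ iU) => t /T2 /andP[t0 _]; split=> // _ /=.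
  by rewrite in_itv/= andbT (lt_le_trans x0).
have [xpi|xpi] := leP x pi.
  have : iapp ([set t | 0 < - sin t] `|` [set t | 0 < - ((cos t - cos x) * 2^-1)]).
    by rewrite -[X in iapp X]setCK setCU; apply/iappC/iappI; exact: iappC.
  apply: iapp_ext => t Tt; have /andP[t0 t2] := T2 _ Tt.
  rewrite /= sin_lt0// in_itv/= andbT; split=> [[|h]|xt]; first exact: le_lt_trans.
    rewrite ltNge; apply/negP => tx.
    have : cos x <= cos t.
      by rewrite leNgt ltr_cos -?leNgt// in_itv/= ?x0 ?t0//= (le_trans tx).
    by lra.
  have [tpi|tpi] := leP t pi; [right|by left].
  have : cos t < cos x by rewrite ltr_cos// in_itv/= ?x0 ?t0//= (le_trans (ltW xt)).
  by lra.
have [x2|x2] := leP (2 * pi) x.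
  apply: (iapp_ext _ iapp_set0) => t /T2 /andP[_ t2]; split=> //=.
  by rewrite in_itv/= andbT; lra.
apply: (iapp_ext _ (iappI isinN (icos x))) => t Tt; have /andP[t0 t2] := T2 _ Tt.
rewrite /= sin_lt0// in_itv/= andbT; have [tpi|tpi] := leP t pi.
  by split=> [[]//|]; lra.
(* Subtracting pi moves both angles into [0, pi], where cos is decreasing. *)
have [e1 e2] := ((cos_sin_Bpi t).1, (cos_sin_Bpi x).1).
have -> : (x < t) = (cos (t - pi) < cos (x - pi)).
  by rewrite ltr_cos ?ltrD2r// in_itv/=; apply/andP; split; lra.
by rewrite e1 e2; split=> [[_]|h]; [lra|split=> //; lra].
Qed.

(** The sets with approximable indicator form a sigma-algebra, and the rays generate the Borel
    sets. *)
Lemma iapp_measurable (A : set R) : measurable A -> iapp A.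
Proof.
move=> mA; have : (@RGenOInfty.G R).-sigma.-measurable A.
  by rewrite -RGenOInfty.measurableE.
apply: smallest_sub => [|_ [x ->]]; last exact: iapp_ray.
split; [exact: iapp_set0|move=> B iB; rewrite setTD; exact: iappC|].
exact: iapp_bigcup.
Qed.

(** Binary expansion: [A] is where the leading digit of [f] is 1, and [2 * f - \1_A] again takes its
    values in [0, 1]. *)
Lemma dyadic_appr n (f : R -> R) : measurable_fun T f ->
  (forall t, T t -> 0 <= f t <= 1) ->
  exists2 g, rapp g & forall t, T t -> `|f t - g t| <= 2^-1 ^+ n.
Proof.
elim: n f => [|n IH] f mf f01.
  exists (fun=> 0); first exact: rapp_cst.
  by move=> t /f01 /andP[f0 f1]; rewrite subr0 expr0 ger0_norm.
pose A := T `&` f @^-1` `[2^-1, +oo[.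
have mA : measurable A by apply: mf => //; exact: measurable_itv.
have [|t Tt|g rg fg] := IH (fun t => 2 * f t - \1_A t).
- by apply: measurable_funB; [exact: measurable_funM|exact: measurable_indic].
- have /andP[f0 f1] := f01 _ Tt; rewrite indicE; case: (boolP (t \in A)).
    by rewrite inE => -[_]; rewrite /= in_itv/= andbT => h; apply/andP; split; lra.
  rewrite notin_setE => nA; have : f t < 2^-1.
    by rewrite ltNge; apply/negP => h; apply: nA; split=> //=; rewrite in_itv/= andbT.
  by move=> h; rewrite subr0; apply/andP; split; lra.
exists (fun t => (g t + \1_A t) * 2^-1).
  apply: rappM; last exact: rapp_cst.
  by apply: rappD => //; exact: iapp_measurable.
move=> t Tt; rewrite exprSr.
have -> : f t - (g t + \1_A t) / 2 = (2 * f t - \1_A t - g t) * 2^-1 by field.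
by rewrite normrM (@ger0_norm _ 2^-1)// ler_wpM2r// fg.
Qed.

Lemma rapp_unit (f : R -> R) : measurable_fun T f ->
  (forall t, T t -> 0 <= f t <= 1) -> rapp f.
Proof.
move=> mf f01.
have /choice [g gP] : forall n : nat, exists g : R -> R, rapp g /\
    forall t, T t -> `|f t - g t| <= 2^-1 ^+ n.
  by move=> n; have [g ? ?] := dyadic_appr n mf f01; exists g.
apply: (@rapp_lim g _ 2) => [n|n t Tt|t Tt]; first exact: (gP n).1.
- have := (gP n).2 _ Tt; have /andP[f0 f1] := f01 _ Tt.
  have : (2^-1 : R) ^+ n <= 1 by rewrite exprn_ile1// invf_le1// ler1n.
  by rewrite !ler_norml => h1 /andP[h2 h3]; apply/andP; split; lra.
- have c0 : (fun n => 2^-1 ^+ n : R) @ \oo --> (0 : R).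
    by apply: cvg_expr; rewrite ger0_norm ?invf_lt1// ltr1n.
  apply/cvgrPdist_le => e e0.
  move/cvgrPdist_le : c0 => /(_ e e0); apply: filterS => n.
  rewrite sub0r normrN ger0_norm ?exprn_ge0// => h.
  exact: (le_trans ((gP n).2 _ Tt)).
Qed.

(** The bound on [f] holds almost everywhere, whereas [rapp_unit] asks for values in [0, 1]
    everywhere on T. Clipping the rescaled function repairs this and changes it on a null set
    only. *)
Lemma rapp_bounded (f : R -> R) : rbd f -> rapp f.
Proof.
move=> bf; have [mf [M fM]] := bf.
pose K := `|M| + 1; have K0 : 0 < K by rewrite ltr_wpDl.
pose clip t := Num.min 1 (Num.max 0 ((f t + K) / (2 * K))).
have mclip : measurable_fun T clip.
  apply: measurable_minr => //; apply: measurable_maxr => //.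
  by apply: measurable_funM => //; exact: measurable_funD.
have rc : rapp (fun t => 2 * K * clip t - K).
  apply: rappB; last exact: rapp_cst.
  apply: rappM; first exact: rapp_cst.
  apply: rapp_unit => // t _.
  by rewrite /clip le_min ler01 le_max lexx ge_min lexx.
apply: tapp_appr; first exact: rbd_Bd.
move=> d d0; exists (fun t => (2 * K * clip t - K)%:C%C) => //.
rewrite (@sqn_ae _ _ (fun=> 0)) ?sqn0 ?ltW//.
- exact: (BdB (rbd_Bd bf) (rbd_Bd (rapp_rbd rc))).1.
apply: ae_onS fM => t _ ftM; have := ler_norm M.
move: ftM; rewrite ler_norml => /andP[h1 h2] h3.
have : 0 <= (f t + K) / (2 * K) by rewrite divr_ge0 ?mulr_ge0 ?ltW// /K; lra.
have : (f t + K) / (2 * K) <= 1 by rewrite ler_pdivrMr ?mulr_gt0// /K; lra.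
rewrite /clip => g1 g0; rewrite (max_idPr g0) (min_idPr g1).
by rewrite -rmorphB; congr (_%:C)%C; field; rewrite gt_eqF.
Qed.

Theorem trig_dense f : Bd f -> tapp f.
Proof.
move=> bf; rewrite (_ : f = fun t => (complex.Re (f t))%:C%C +
    'i%C * (complex.Im (f t))%:C%C); last first.
  by apply/funext => t; rewrite -complexE.
apply: tappD; first exact/rapp_bounded/Bd_Re.
by apply: tappM; [exact/trig_tapp/trig_cst|exact/rapp_bounded/Bd_Im].
Qed.

End Density.

(** * Bounded functions in the Hardy space *)

Section Orthogonality.
Variable R : realType.
Local Notation C := (R[i]).
Local Notation T := (@Tset R).
Local Notation mu := (@lebesgue_measure R).

Lemma rmean_derive (f F : R -> R) : rbd f -> continuous f ->
  (forall x : R, is_derive x (1 : R) F (f x)) -> F (2 * pi) = F 0 -> rmean f = 0.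
Proof.
move=> bf cf dF F20; rewrite /rmean.
have p0 : 0 < 2 * pi :> R by rewrite mulr_gt0 ?pi_gt0.
suff -> : Rintegral mu T f = 0 by rewrite mulr0.
(* [T] is half-open; adding its endpoint gives the closed interval on which the fundamental theorem
   of calculus is applied. *)
have := Rintegral_itv_bndo_bndc (rbd_integrable bf).
move=> ->; rewrite /Rintegral.
have cF : continuous F.
  move=> x; apply: differentiable_continuous; apply/derivable1_diffP.
  by have [] := dF x.
rewrite (@continuous_FTC2 _ f F)//.
- by rewrite F20 /= subrr.
- exact: continuous_subspaceT.
- split.
  + by move=> x _; have [] := dF x.
  + exact: cvg_at_right_filter (cF _).
  + exact: cvg_at_left_filter (cF _).
- by move=> x _; rewrite derive1E; have [_ ->] := dF x.
Qed.

Lemma expi_2pi (k : int) : expi (k%:~R * (2 * pi)) = 1 :> C.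
Proof.
have e1 : expi (2 * pi) = 1 :> C.
  by rewrite /expi mulr_natl cos2pi sin2pi.
case: k => n; first by rewrite -pmulrn -expiX e1 expr1n.
by rewrite NegzE rmorphN /= mulNr expiN -pmulrn -expiX e1 expr1n conjc1.
Qed.

Lemma cmean_expi (k : int) : k != 0 -> cmean (fun t : R => expi (k%:~R * t)) = 0.
Proof.
move=> k0; have kR : k%:~R != 0 :> R by rewrite intr_eq0.
have bk := @Bd_expi R k%:~R; have [e1 e2] : cos (k%:~R * (2 * pi)) = 1 :> R /\
    sin (k%:~R * (2 * pi)) = 0 :> R.
  by have := expi_2pi k; rewrite /expi => -[].
rewrite cmeanE /=; congr Complex.
- apply: (@rmean_derive _ (fun t => k%:~R^-1 * sin (k%:~R * t))).
  + exact: Bd_Re bk.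
  + move=> x; apply: continuous_comp; last exact: continuous_cos.
    exact: mulrl_continuous.
  + move=> x; apply: is_derive_eq; rewrite /GRing.scale/=; field => //.
  + by rewrite e2 !mulr0 sin0 mulr0.
- apply: (@rmean_derive _ (fun t => - k%:~R^-1 * cos (k%:~R * t))).
  + exact: Bd_Im bk.
  + move=> x; apply: continuous_comp; last exact: continuous_sin.
    exact: mulrl_continuous.
  + move=> x; apply: is_derive_eq; rewrite /GRing.scale/=; field => //.
  + by rewrite e1 mulr0 cos0.
Qed.

End Orthogonality.

(** * Partial sums as best approximations, and products in H^oo *)

Section Hardy_bounded.
Variable R : realType.
Local Notation C := (R[i]).
Implicit Types f g h : fn R.

Lemma conjcM (x y : C) : conjc (x * y) = conjc x * conjc y.
Proof. exact: rmorphM. Qed.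

Lemma conjcD (x y : C) : conjc (x + y) = conjc x + conjc y.
Proof. exact: rmorphD. Qed.

Lemma Bd_expiN (n : int) : Bd (fun t : R => expi (- (n%:~R * t))).
Proof. by have := @Bd_expi R (- n%:~R); under eq_fun do rewrite mulNr. Qed.

Lemma expiN_add (m n : int) (t : R) :
  expi (- ((m + n)%:~R * t)) = expi (- (m%:~R * t)) * expi (- (n%:~R * t)).
Proof. by rewrite -expiD rmorphD /= mulrDl opprD. Qed.

Lemma fourier0 f : fourier f 0 = cmean f.
Proof.
rewrite /fourier; congr cmean; apply/funext => t.
by rewrite mul0r oppr0 expi0 mulr1.
Qed.

Lemma fourierB f g n : Bd f -> Bd g ->
  fourier (fun t => f t - g t) n = fourier f n - fourier g n.
Proof.
move=> bf bg; rewrite /fourier -cmeanB; [|exact/BdM/Bd_expiN|exact/BdM/Bd_expiN].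
by congr cmean; apply/funext => t; rewrite mulrBl.
Qed.

Lemma fourierZ c f n : Bd f -> fourier (fun t => c * f t) n = c * fourier f n.
Proof.
move=> bf; rewrite /fourier -cmeanZ; last exact/BdM/Bd_expiN.
by congr cmean; apply/funext => t; rewrite mulrA.
Qed.

Lemma fourier_shift f (m n : int) :
  fourier (fun t => f t * expi (- (m%:~R * t))) n = fourier f (m + n).
Proof.
rewrite /fourier; congr cmean; apply/funext => t.
by rewrite expiN_add mulrA.
Qed.

Lemma horner_expi (P : {poly C}) (t : R) :
  P.[expi t] = \sum_(i < size P) P`_i * expi (i%:R * t).
Proof. by rewrite horner_coef; under eq_bigr do rewrite expiX. Qed.

Lemma cmean_mul_poly (P : {poly C}) g : Bd g ->
  cmean (fun t => P.[expi t] * g t) = \sum_(i < size P) P`_i * fourier g (- i%:Z).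
Proof.
move=> bg; under [X in cmean X]eq_fun do rewrite horner_expi mulr_suml.
rewrite (@cmean_sum _ _ _ (fun (i : 'I_(size P)) t => P`_i * expi (i%:R * t) * g t)).
  apply: eq_bigr => i _; rewrite /fourier -cmeanZ; last exact/BdM/Bd_expiN.
  by congr cmean; apply/funext => t; rewrite rmorphN mulNr opprK /=; ring.
by move=> i; apply: BdM => //; apply: BdM; [exact: Bd_cst|exact: Bd_expi].
Qed.

Lemma fourier_cst1 (n : int) : fourier (fun=> 1) n = (n == 0)%:R :> C.
Proof.
have [->|n0] := eqVneq n 0; first by rewrite fourier0 cmean_cst.
rewrite /fourier; under [X in cmean X]eq_fun do rewrite mul1r -mulNr -rmorphN.
by rewrite cmean_expi ?oppr_eq0.
Qed.

Lemma fourier_poly (P : {poly C}) (n : int) :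
  fourier (fun t : R => P.[expi t]) n = if n is Posz k then P`_k else 0.
Proof.
rewrite /fourier cmean_mul_poly; last exact: Bd_expiN.
under eq_bigr => i _.
  rewrite (_ : fourier _ _ = (n == i%:Z)%:R); last first.
    under [X in fourier X]eq_fun do rewrite -[expi _]mul1r.
    by rewrite fourier_shift fourier_cst1 subr_eq0.
  over.
case: n => k; last by rewrite big1// => i _; rewrite mulr0.
have [kP|kP] := ltnP k (size P).
  rewrite (bigD1 (Ordinal kP))//= eqxx mulr1 big1 ?addr0// => i ik.
  by rewrite eqz_nat eq_sym; move: ik; rewrite -val_eqE/= => /negPf ->; rewrite mulr0.
rewrite big1 ?nth_default// => i _.
by rewrite eqz_nat gtn_eqF ?mulr0// (leq_trans (ltn_ord i)).
Qed.

Lemma sqn_add f g : Bd f -> Bd g -> sqn (fun t => f t + g t) =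
  sqn f + sqn g + 2 * complex.Re (cmean (fun t => f t * star g t)).
Proof.
move=> bf bg; have bfg : Bd (fun t => f t * star g t) by apply/BdM/Bd_conj.
have [[b1 b2] b3] := (Bd_sqr bf, Bd_sqr bg, Bd_Re bfg).
have b4 := rbdM (rbd_cst 2) b3.
rewrite cmeanE /= /sqn -(rmeanZ _ b3) -(rmeanD b1 b2) -(rmeanD (rbdD b1 b2) b4).
congr rmean; apply/funext => t; rewrite !sqr_cmod /star.
by case: (f t) => a b; case: (g t) => c d /=; ring.
Qed.

Definition psum f (M : nat) : {poly C} := \poly_(k < M) fourier f k%:Z.

Lemma fourier_psum f M (n : int) : n < M%:Z -> H2D f ->
  fourier (fun t => (psum f M).[expi t]) n = fourier f n.
Proof.
move=> nM [_ hf]; rewrite fourier_poly; case: n nM => [k|k] nM.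
  by rewrite coef_poly -ltz_nat nM.
by rewrite hf.
Qed.

(** Pythagoras. The coefficients of [f - psum f M] vanish at all indices below [M], the negative
    ones included because [f] is in H^2(D), while [psum f M - g] has frequencies below [M] only.
    Discarding the negative frequencies of an approximant thus costs nothing. *)
Lemma psum_best f g N (P : {poly C}) M : Bd f -> H2D f ->
  g = (fun t => expi (- (N%:R * t)) * P.[expi t]) -> (size P <= M)%N ->
  sqn (fun t => f t - (psum f M).[expi t]) <= sqn (fun t => f t - g t).
Proof.
move=> bf hf gE PM; set Q := psum f M.
have bQ : Bd (fun t : R => Q.[expi t]) by exact: Bd_poly_expi.
(* [w] is [psum f M - g], written with the shift [N] of [g]; its frequencies are j - N with j < N +
   M. *)
pose W := 'X^N * Q - P.
pose w (t : R) := expi (- (N%:R * t)) * W.[expi t].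
have bw : Bd w by apply: trig_Bd; exists N, W.
have -> : (fun t => f t - g t) = (fun t => (f t - Q.[expi t]) + w t).
  apply/funext => t; rewrite gE /w /W hornerD hornerN hornerM hornerXn expiX.
  rewrite mulrBr mulrA -expiD addNr expi0 mul1r; ring.
have bh := BdB bf bQ; rewrite (sqn_add bh bw).
rewrite [X in complex.Re X](_ : _ = 0) /= ?mulr0 ?addr0 ?lerDl ?sqn_ge0//.
have WM : (size W <= N + M)%N.
  rewrite /W (leq_trans (size_polyD _ _))// geq_max size_polyN.
  rewrite (leq_trans PM) ?leq_addl// andbT.
  rewrite (leq_trans (size_polyMleq _ _))// size_polyXn addSn /= leq_add2l.
  exact: size_poly.
have wE t : star w t = \sum_(j < size W) conjc W`_j * expi (- ((j%:Z - N%:Z)%:~R * t)).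
  rewrite /star /w horner_expi mulr_sumr rmorph_sum; apply: eq_bigr => j _.
  have e (x : R) : conjc (expi x) = expi (- x) by rewrite expiN.
  rewrite -[LHS]/(conjc (expi (- (N%:R * t)) * (W`_j * expi (j%:R * t)))).
  rewrite !conjcM !e opprK mulrCA -expiD; congr (_ * expi _).
  by rewrite rmorphB /= -!pmulrn; ring.
under [X in cmean X]eq_fun do rewrite wE mulr_sumr.
rewrite (@cmean_sum _ _ _ (fun (j : 'I_(size W)) t => (f t - Q.[expi t]) *
    (conjc W`_j * expi (- ((j%:Z - N%:Z)%:~R * t))))); last first.
  by move=> j; apply: BdM => //; apply: BdM; [exact: Bd_cst|exact: Bd_expiN].
rewrite big1// => j _.
under [X in cmean X]eq_fun do rewrite mulrCA.
rewrite cmeanZ; last by apply: BdM => //; exact: Bd_expiN.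
rewrite -/(fourier (fun t => f t - Q.[expi t]) _) fourierB// fourier_psum//.
  by rewrite subrr mulr0.
by rewrite ltrBlDl -PoszD ltz_nat (leq_trans (ltn_ord j)).
Qed.

Lemma psum_cvg f : Bd f -> H2D f -> forall d : R, 0 < d -> exists M0, forall M,
  (M0 <= M)%N -> sqn (fun t => f t - (psum f M).[expi t]) <= d.
Proof.
move=> bf hf d d0; have [_ /(_ d d0)[g [N [P gE]] fg]] := trig_dense bf.
exists (size P) => M PM; exact: (le_trans (psum_best bf hf gE PM)).
Qed.

Lemma cmod_small_eq0 (z : C) (K : R) : (forall d : R, 0 < d -> cmod z <= K * d) ->
  z = 0.
Proof.
move=> h; apply/eqP; rewrite -cmod_eq0; apply/negPn/negP => z0.
have z_gt0 : 0 < cmod z by rewrite lt_neqAle eq_sym z0 cmod_ge0.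
have K1 : 0 < 2 * (`|K| + 1) by rewrite mulr_gt0// ltr_wpDl.
have d0 : 0 < cmod z / (2 * (`|K| + 1)) by exact: divr_gt0.
have := h _ d0; rewrite leNgt => /negP; apply.
rewrite mulrA ltr_pdivrMr// mulrC.
have := ler_norm K; have := normr_ge0 K; nra.
Qed.

(** With [f] replaced by a partial sum [Q], only the product of the zeroth coefficients survives,
    since [g] has no negative ones. [cmean_small] controls the replacement. *)
Lemma cmean_mul f g : Bd f -> Bd g -> H2D f -> H2D g ->
  cmean (fun t => f t * g t) = cmean f * cmean g.
Proof.
move=> bf bg hf hg; have [_ [M gM]] := bg.
have gM' : ae_on (fun t => cmod (g t) <= `|M|).
  by apply: ae_onS gM => t _ /le_trans; apply; exact: ler_norm.
apply/eqP; rewrite -subr_eq0; apply/eqP.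
apply: (@cmod_small_eq0 _ (2 * `|M|)) => d d0.
have [M0 hM0] := psum_cvg bf hf (exprn_gt0 2 d0).
have {hM0} h := hM0 M0.+1 (leqnSn _); set Q := psum _ _ in h.
have bQ : Bd (fun t : R => Q.[expi t]) by exact: Bd_poly_expi.
have -> : cmean f * cmean g = cmean (fun t => Q.[expi t] * g t).
  rewrite cmean_mul_poly//.
  (* The sum is padded to [M0.+1] terms so that the index 0 occurs even if [Q] is the zero
     polynomial. *)
  transitivity (\sum_(i < M0.+1) Q`_i * fourier g (- i%:Z)).
    rewrite big_ord_recl /= oppr0 fourier0 coef_poly/= fourier0 big1 ?addr0//.
    by move=> i _; rewrite hg.2 ?mulr0// oppr_lt0.
  rewrite -(big_mkord xpredT (fun i => Q`_i * fourier g (- i%:Z))).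
  rewrite (big_cat_nat _ (n := size Q))//=; last exact: size_poly.
  rewrite big_mkord [X in _ + X]big_nat_cond [X in _ + X]big1 ?addr0//.
  by move=> i /andP[/andP[ki _] _]; rewrite nth_default// mul0r.
rewrite -cmeanB; [|exact: BdM|exact: BdM].
under [X in cmean X]eq_fun do rewrite -mulrBl.
rewrite -mulrA; apply: cmean_small => //; exact: BdB.
Qed.

(* H^oo, through boundary values. *)
Definition Hb f := Bd f /\ H2D f.

Lemma Hb_coef f : Bd f -> (forall n : int, n < 0 -> fourier f n = 0) -> Hb f.
Proof. by move=> bf h; split=> //; split=> //; exact: Bd_L2. Qed.

(** For n < 0 the function g e^{-int} is again in H^oo, so the n-th coefficient of f g is the mean
    of f times the n-th coefficient of g, which is 0. *)
Lemma HbM f g : Hb f -> Hb g -> Hb (fun t => f t * g t).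
Proof.
move=> [bf hf] [bg hg]; apply: Hb_coef; first exact: BdM.
move=> n n0; rewrite /fourier; under [X in cmean X]eq_fun do rewrite -mulrA.
have bgn : Bd (fun t => g t * expi (- (n%:~R * t))) by apply/BdM/Bd_expiN.
rewrite cmean_mul//.
  by rewrite -[X in _ * X]/(fourier g n) hg.2 ?mulr0.
apply: (Hb_coef bgn _).2 => m m0; rewrite fourier_shift hg.2//.
by rewrite (lt_trans _ m0)// gtrDr.
Qed.

Lemma HbB f g : Hb f -> Hb g -> Hb (fun t => f t - g t).
Proof.
move=> [bf hf] [bg hg]; apply: Hb_coef; first exact: BdB.
by move=> n n0; rewrite fourierB// hf.2// hg.2// subrr.
Qed.

Lemma HbZ c f : Hb f -> Hb (fun t => c * f t).
Proof.
move=> [bf hf]; apply: Hb_coef; first by apply: BdM => //; exact: Bd_cst.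
by move=> n n0; rewrite fourierZ// hf.2// mulr0.
Qed.

Lemma Hb_mean f g : Hb f -> Hb g -> cmean (fun t => f t * g t) = cmean f * cmean g.
Proof. by move=> [? ?] [? ?]; exact: cmean_mul. Qed.

End Hardy_bounded.

(** * Polynomial approximation without zeros in the disc *)

Section PowerSeries.
Variable R : realType.
Local Notation C := (R[i]).
Implicit Types (K r : R) (u : nat -> R).

Lemma geometric_tail K r u N m : 0 <= K -> 0 <= r < 1 ->
  (forall k, `|u k| <= K * r ^+ k) ->
  `|\sum_(N <= k < N + m) u k| <= K * r ^+ N / (1 - r).
Proof.
move=> K0 /andP[r0 r1] uK.
have r1' : 0 < 1 - r by lra.
(* The exact geometric sum, which makes the induction on [m] close with equality. *)
apply: (@le_trans _ _ (K * (r ^+ N - r ^+ (N + m)) / (1 - r))); last first.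
  rewrite ler_pM2r ?invr_gt0// ler_wpM2l// lerBlDr lerDl exprn_ge0//.
elim: m => [|m IH].
  by rewrite addn0 subrr mulr0 mul0r big_geq// normr0.
rewrite addnS big_nat_recr ?leq_addr//= (le_trans (ler_normD _ _))//.
rewrite (le_trans (lerD IH (uK _)))// exprS le_eqVlt; apply/orP; left; apply/eqP.
by field; rewrite gt_eqF.
Qed.

Lemma geometric_lim K r u N : 0 <= K -> 0 <= r < 1 ->
  (forall k, `|u k| <= K * r ^+ k) ->
  `|limn (fun n => \sum_(0 <= k < n) u k) - \sum_(0 <= k < N) u k|
    <= K * r ^+ N / (1 - r).
Proof.
move=> K0 r01 uK; have /andP[r0 r1] := r01.
have cu : cvgn (series u).
  apply: normed_cvg; apply: (@series_le_cvg _ _ (geometric K r)) => //.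
  - by move=> n; rewrite normr_ge0.
  - by move=> n; rewrite mulr_ge0// exprn_ge0.
  - by apply: is_cvg_geometric_series; rewrite ger0_norm.
apply/ler_addgt0Pr => e e0.
move/cvgrPdist_le: cu => /(_ e e0)[M _ hM].
have := hM (N + M)%N (leq_addl _ _); rewrite /= /series /= => h.
have -> : limn (fun n => \sum_(0 <= k < n) u k) - \sum_(0 <= k < N) u k =
    (limn (fun n => \sum_(0 <= k < n) u k) - \sum_(0 <= k < N + M) u k) +
    \sum_(N <= k < N + M) u k.
  by rewrite (@big_cat_nat _ _ _ N 0 (N + M)) ?leq_addr//=; ring.
by rewrite (le_trans (ler_normD _ _))// addrC lerD//; exact: geometric_tail.
Qed.

Lemma fourier_bound (f : fn R) : Bd f ->
  exists2 K, 0 <= K & forall n, cmod (fourier f n) <= K.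
Proof.
move=> bf; exists (2 * rmean (fun t => cmod (f t))).
  apply: mulr_ge0 => //; apply: rmean_ge0; first exact: Bd_cmod.
  by apply: ae_on_all => t _; exact: cmod_ge0.
move=> n; apply: (le_trans (cmod_cmean_le _)); first exact/BdM/Bd_expiN.
rewrite le_eqVlt; apply/orP; left; apply/eqP; congr (_ * rmean _).
by apply/funext => t; rewrite cmodM cmod_expi mulr1.
Qed.

(** [extD] is built from separate limits of real and imaginary parts; each contributes one geometric
    tail, whence the factor 2. *)
Lemma extD_psum (f : fn R) K r N (z : C) : 0 <= K -> 0 <= r < 1 ->
  (forall n, cmod (fourier f n) <= K) -> cmod z <= r ->
  cmod (extD f z - (psum f N).[z]) <= 2 * (K * r ^+ N / (1 - r)).
Proof.
move=> K0 r01 fK zr; rewrite horner_poly.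
have uK k : cmod (fourier f k%:Z * z ^+ k) <= K * r ^+ k.
  rewrite cmodM cmodX ler_pM ?cmod_ge0 ?exprn_ge0 ?cmod_ge0//.
  by rewrite lerXn2r ?nnegrE ?cmod_ge0//; case/andP: r01.
have uRe k : `|complex.Re (fourier f k%:Z * z ^+ k)| <= K * r ^+ k.
  exact: (le_trans (Re_le_cmod _)).
have uIm k : `|complex.Im (fourier f k%:Z * z ^+ k)| <= K * r ^+ k.
  exact: (le_trans (Im_le_cmod _)).
rewrite (_ : \sum_(i < N) _ =
    Complex (\sum_(0 <= k < N) complex.Re (fourier f k%:Z * z ^+ k))
            (\sum_(0 <= k < N) complex.Im (fourier f k%:Z * z ^+ k))); last first.
  rewrite !big_mkord; elim: N => [|n IH]; first by rewrite !big_ord0.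
  rewrite !big_ord_recr/= IH; case: (fourier f n%:Z * z ^+ n) => a b.
  by [].
rewrite (le_trans (cmod_le_ReIm _))// mulr_natl mulr2n lerD//.
- exact: (geometric_lim N K0 r01 uRe).
- exact: (geometric_lim N K0 r01 uIm).
Qed.

Lemma extD0 (f : fn R) : Bd f -> extD f 0 = cmean f.
Proof.
move=> bf; have [K K0 fK] := fourier_bound bf.
apply/eqP; rewrite -subr_eq0; apply/eqP.
(* For r = 0 and N = 1 the tail bound is 0, which leaves exactly the constant term. *)
have := @extD_psum f K 0 1 0 K0; rewrite lexx ltr01 cmod0 => /(_ erefl fK (lexx _)).
rewrite expr1 mulr0 mul0r mulr0 horner_poly big_ord_recl big_ord0 expr0 mulr1 addr0.
rewrite fourier0 => h; apply/eqP; rewrite -cmod_eq0; apply/eqP/le_anti.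
by rewrite h cmod_ge0.
Qed.

End PowerSeries.

(** * Parseval for polynomials, and radial dilation *)

Section Dilation.
Variable R : realType.
Local Notation C := (R[i]).
Implicit Types (f g : fn R) (P Q : {poly C}).

Lemma sqn_cmean g : Bd g -> sqn g = complex.Re (cmean (fun t => g t * star g t)).
Proof.
move=> bg; rewrite cmeanE /= /sqn; congr rmean; apply/funext => t.
by rewrite /star mulcJ.
Qed.

Lemma fourier_star f (n : int) : Bd f -> fourier (star f) (- n) = conjc (fourier f n).
Proof.
move=> bf; rewrite /fourier -cmean_conj; last exact/BdM/Bd_expiN.
congr cmean; apply/funext => t; rewrite /star conjcM rmorphN mulNr opprK.
by rewrite expiN conjcK.
Qed.

Lemma parseval_poly P :
  sqn (fun t : R => P.[expi t]) = \sum_(i < size P) cmod P`_i ^+ 2.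
Proof.
have bP : Bd (fun t : R => P.[expi t]) by exact: Bd_poly_expi.
rewrite sqn_cmean// cmean_mul_poly; last exact: Bd_conj.
under eq_bigr do rewrite fourier_star// fourier_poly mulcJ.
by elim/big_ind2 : _ => // x1 x2 y1 y2 <- <-; rewrite ReD.
Qed.

Definition dilate (r : R) P : {poly C} := P \Po (r%:C%C *: 'X).

Lemma horner_dilate r P z : (dilate r P).[z] = P.[r%:C%C * z].
Proof. by rewrite /dilate horner_comp hornerZ hornerX. Qed.

Lemma dilateB r P Q : dilate r (P - Q) = dilate r P - dilate r Q.
Proof. by rewrite /dilate rmorphB. Qed.

Lemma coef_dilate r P i : (dilate r P)`_i = (r%:C%C) ^+ i * P`_i.
Proof.
elim/poly_ind: P i => [|P c IH] i; first by rewrite /dilate comp_poly0 coef0 mulr0.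
rewrite /dilate comp_polyD comp_polyM comp_polyX comp_polyC -/(dilate r P).
rewrite -scalerAr !coefD !coefC coefZ !coefMX; case: i => [|i] /=.
  by rewrite mulr0 !add0r expr0 mul1r.
by rewrite !addr0 IH exprS mulrA.
Qed.

(** By Parseval, as dilation multiplies the i-th coefficient by r^i. The sizes are compared
    separately because the degree drops at r = 0. *)
Lemma sqn_dilate r P : 0 <= r <= 1 ->
  sqn (fun t : R => (dilate r P).[expi t]) <= sqn (fun t : R => P.[expi t]).
Proof.
move=> /andP[r0 r1]; rewrite !parseval_poly.
have sP : (size (dilate r P) <= size P)%N.
  apply/leq_sizeP => j Pj; rewrite coef_dilate nth_default ?mulr0//.
rewrite -(big_mkord xpredT (fun i => cmod (dilate r P)`_i ^+ 2)).
rewrite -(big_mkord xpredT (fun i => cmod P`_i ^+ 2)).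
rewrite [leRHS](big_cat_nat _ (n := size (dilate r P)))//= -[leLHS]addr0.
apply: lerD; last by apply: sumr_ge0 => i _; exact: sqr_ge0.
apply: ler_sum => i _; rewrite coef_dilate cmodM exprMn ler_piMl ?sqr_ge0//.
rewrite cmodX cmod_real ger0_norm// exprn_ile1 ?exprn_ge0//.
by rewrite exprn_ile1.
Qed.

Lemma poly_disc_bound P : exists2 M, 0 <= M &
  forall z, cmod z <= 1 -> cmod P.[z] <= M.
Proof.
elim/poly_ind: P => [|P c [M M0 PM]].
  by exists 0 => // z _; rewrite horner0 cmod0.
exists (M + cmod c); first by rewrite addr_ge0 ?cmod_ge0.
move=> z z1; rewrite hornerD hornerM hornerX hornerC.
rewrite (le_trans (cmodD _ _))// lerD2r cmodM.
by rewrite -[leRHS]mulr1 ler_pM ?cmod_ge0 ?PM.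
Qed.

Lemma poly_dilate_near P : exists2 L, 0 <= L & forall (r : R) z,
  0 <= r <= 1 -> cmod z <= 1 -> cmod (P.[z] - (dilate r P).[z]) <= L * (1 - r).
Proof.
elim/poly_ind: P => [|P c [L L0 PL]].
  exists 0 => // r z _ _; rewrite horner_dilate !horner0 subr0 cmod0 mul0r//.
have [M M0 PM] := poly_disc_bound P.
exists (L + M); first by rewrite addr_ge0.
move=> r z r01 z1; have := PL r z r01 z1; rewrite !horner_dilate => h.
have /andP[r0 r1] := r01.
have rz1 : cmod (r%:C%C * z) <= 1.
  by rewrite cmodM cmod_real ger0_norm// mulr_ile1 ?cmod_ge0.
rewrite !hornerD !hornerM !hornerX !hornerC.
have -> : P.[z] * z + c - (P.[r%:C%C * z] * (r%:C%C * z) + c) =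
    z * ((P.[z] - P.[r%:C%C * z]) + (1 - r)%:C%C * P.[r%:C%C * z]).
  by rewrite rmorphB rmorph1; ring.
rewrite cmodM (@le_trans _ _ (1 * (L * (1 - r) + (1 - r) * M)))//; last first.
  by lra.
rewrite ler_pM ?cmod_ge0// (le_trans (cmodD _ _))// lerD//.
rewrite cmodM cmod_real ger0_norm ?subr_ge0// ler_wpM2l ?subr_ge0//.
exact: PM.
Qed.

Lemma sqn_bounded g M : Bd g -> 0 <= M -> (forall t, cmod (g t) <= M) ->
  sqn g <= M ^+ 2.
Proof.
move=> bg M0 gM; rewrite -(rmean_cst (M ^+ 2)); apply: rmean_le.
- exact: Bd_sqr.
- exact: rbd_cst.
- by apply: ae_on_all => t _; rewrite ler_pXn2r ?nnegrE ?cmod_ge0.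
Qed.

Lemma sqnN g : sqn (fun t => - g t) = sqn g.
Proof. by rewrite /sqn; under eq_fun do rewrite cmodN. Qed.

(* Radial dilates of Fourier partial sums approximate [f] in mean square while
   staying as far from zero on the closed disc as the extension of [f]. *)
Lemma nonvanishing_poly_appr f (c0 c : R) : Bd f -> H2D f -> c < c0 ->
  (forall z, cmod z < 1 -> c0 <= cmod (extD f z)) ->
  forall d : R, 0 < d -> exists2 P, (forall z, cmod z <= 1 -> c <= cmod P.[z]) &
    sqn (fun t => f t - P.[expi t]) <= d.
Proof.
move=> bf hf cc0 fc0 d d0; have [K K0 fK] := fourier_bound bf.
(* The order of choices avoids a circle: [N] makes a partial sum close to [f], [L] measures its
   response to dilation, [r] is taken close to 1 accordingly, and only then is [M] so large that the
   tail at radius [r] is at most [c0 - c]. Bounding [e] by 1 gives r >= 1/2 and e^2 <= e. *)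
have d1 : 0 < d / 32 by rewrite divr_gt0.
have [N hN] := psum_cvg bf hf d1.
have [L L0 hL] := poly_dilate_near (psum f N).
pose e := Num.min 1 (d / 32); have e0 : 0 < e by rewrite lt_min ltr01.
pose r := 1 - e / (2 * (L + 1)).
have L1 : 0 < 2 * (L + 1) by rewrite mulr_gt0// ltr_wpDl.
have er : 0 < e / (2 * (L + 1)) by rewrite divr_gt0.
have e1 : e <= 1 by rewrite ge_min lexx.
have er1 : e / (2 * (L + 1)) <= 1 / 2.
  rewrite ler_pdivrMr// (le_trans e1)//; lra.
have r01 : 0 <= r < 1 by rewrite /r; apply/andP; split; lra.
have r01' : 0 <= r <= 1 by rewrite /r; apply/andP; split; lra.
have Lr : L * (1 - r) <= e.
  have -> : L * (1 - r) = (L / (2 * (L + 1))) * e.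
    by rewrite /r; field; rewrite gt_eqF//; lra.
  by apply: ler_piMl; [exact: ltW|rewrite ler_pdivrMr//; lra].
have [M NM hM] : exists2 M, (N <= M)%N & 2 * (K * r ^+ M / (1 - r)) <= c0 - c.
  have cr : (fun M => 2 * (K / (1 - r)) * r ^+ M) @ \oo --> (2 * (K / (1 - r)) * 0 : R).
    apply: cvgM; first exact: cvg_cst.
    by apply: cvg_expr; case/andP: r01 => ? ?; rewrite ger0_norm.
  rewrite mulr0 in cr; have cc : 0 < c0 - c by rewrite subr_gt0.
  move/cvgr_le: cr => /(_ _ cc)[M _ h].
  exists (N + M)%N; first exact: leq_addr.
  have := h (N + M)%N (leq_addl _ _) => /=.
  by apply: le_trans; rewrite le_eqVlt; apply/orP; left; apply/eqP; ring.
exists (dilate r (psum f M)) => [z z1|].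
  rewrite horner_dilate.
  have rz : cmod (r%:C%C * z) <= r.
    have /andP[r0 _] := r01.
    by rewrite cmodM cmod_real ger0_norm// ler_piMr.
  have h1 := fc0 _ (le_lt_trans rz (andP r01).2).
  have h2 := extD_psum M K0 r01 fK rz.
  have := cmodB_ge (extD f (r%:C%C * z)) (psum f M).[r%:C%C * z]; lra.
(* Since [L] belongs to [psum f N] and not to [psum f M], the dilates of these two are compared
   through [sqn_dilate]. The three errors, with the doublings of [sqnD], add up to at most d/16 +
   d/8 + d/2. *)
have -> : (fun t => f t - (dilate r (psum f M)).[expi t]) =
    (fun t => (f t - (psum f N).[expi t]) +
      (((psum f N).[expi t] - (dilate r (psum f N)).[expi t]) +
       (dilate r (psum f N - psum f M)).[expi t])).
  by apply/funext => t; rewrite dilateB hornerD hornerN; ring.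
have bp P : Bd (fun t : R => P.[expi t]) by exact: Bd_poly_expi.
apply: (le_trans (sqnD (BdB bf (bp _)) (BdD (BdB (bp _) (bp _)) (bp _)))).
have s1 := hN N (leqnn N); have s1' := hN M NM.
have s2 := sqnD (BdB (bp (psum f N)) (bp (dilate r (psum f N))))
  (bp (dilate r (psum f N - psum f M))).
have s3 : sqn (fun t : R => (psum f N).[expi t] - (dilate r (psum f N)).[expi t])
    <= d / 32.
  apply: (@le_trans _ _ (e ^+ 2)).
    apply: sqn_bounded; [exact: BdB|exact: ltW|].
    by move=> t; rewrite (le_trans (hL _ _ r01' _))// cmod_expi.
  rewrite expr2 (@le_trans _ _ e)//; first by rewrite ler_piMl// ltW.
  by rewrite ge_min lexx orbT.
have s4 := sqn_dilate (psum f N - psum f M) r01'.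
have s5 : sqn (fun t : R => (psum f N - psum f M).[expi t]) <= d / 8.
  have -> : (fun t : R => (psum f N - psum f M).[expi t]) =
      (fun t => - (f t - (psum f N).[expi t]) + (f t - (psum f M).[expi t])).
    by apply/funext => t; rewrite hornerD hornerN; ring.
  apply: (le_trans (sqnD (BdN (BdB bf (bp _))) (BdB bf (bp _)))).
  by rewrite sqnN; lra.
lra.
Qed.

End Dilation.

(** * Inverses in the Hardy space *)

Section Inverse.
Variable R : realType.
Local Notation C := (R[i]).
Local Notation T := (@Tset R).
Local Notation mu := (@lebesgue_measure R).
Implicit Types (f g : fn R) (P Q : {poly C}).

(* Uniform closure on [T] of the analytic polynomials. *)
Definition disc_algebra g := forall d : R, 0 < d ->
  exists Q, forall t, cmod (g t - Q.[expi t]) <= d.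

Lemma disc_algebra_cst c : disc_algebra (fun=> c).
Proof.
by move=> d d0; exists c%:P => t; rewrite hornerC subrr cmod0 ltW.
Qed.

Lemma disc_algebraM f g : disc_algebra f -> disc_algebra g ->
  disc_algebra (fun t => f t * g t).
Proof.
(* [Q1] serves to bound [g]. The tolerance for [f] depends on that bound, and the tolerance for [g]
   on the bound of [P], so [P] is chosen before [Q]. *)
move=> af ag d d0; have [Q1 h1] := ag 1 ltr01.
have [M M0 QM] := poly_expi_bounded Q1.
have e0 : 0 < d / 2 / (M + 1 + 1) by rewrite !divr_gt0// addr_gt0// ltr_wpDl.
have [P hP] := af _ e0; have [K K0 PK] := poly_expi_bounded P.
have e1 : 0 < d / 2 / (K + 1) by rewrite !divr_gt0// ltr_wpDl.
have [Q hQ] := ag _ e1; exists (P * Q) => t; rewrite hornerM.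
have gM : cmod (g t) <= M + 1.
  have := cmodB_ge (g t) Q1.[expi t]; have := h1 t; have := QM t; lra.
have -> : f t * g t - P.[expi t] * Q.[expi t] =
  (f t - P.[expi t]) * g t + P.[expi t] * (g t - Q.[expi t]) by ring.
rewrite (le_trans (cmodD _ _))// !cmodM.
apply: (@le_trans _ _ (d / 2 / (M + 1 + 1) * (M + 1) + K * (d / 2 / (K + 1)))).
  by apply: lerD; apply: ler_pM; rewrite ?cmod_ge0.
have h2 : d / 2 / (M + 1 + 1) * (M + 1) <= d / 2.
  rewrite mulrAC ler_pdivrMr; nra.
have h3 : K * (d / 2 / (K + 1)) <= d / 2.
  rewrite mulrA ler_pdivrMr; nra.
lra.
Qed.

Lemma geometric_expansion (w z : C) n : z != 0 -> w != z ->
  (w - z)^-1 - - z^-1 * (\sum_(k < n) (w / z) ^+ k) = (w / z) ^+ n * (w - z)^-1.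
Proof.
move=> z0 wz; have wz0 : w - z != 0 by rewrite subr_eq0.
elim: n => [|n IH]; first by rewrite big_ord0 mulr0 subr0 mul1r.
rewrite big_ord_recr /= mulrDr opprD addrA IH exprS.
by field; rewrite z0 wz0.
Qed.

Lemma disc_algebra_inv_root (z : C) : 1 < cmod z ->
  disc_algebra (fun t => (expi t - z)^-1).
Proof.
move=> z1 d d0; have z_gt0 : 0 < cmod z by exact: lt_trans z1.
have z0 : z != 0 by rewrite -cmod_eq0 gt_eqF.
have cz : (fun n => (cmod z)^-1 ^+ n / (cmod z - 1)) @ \oo -->
    (0 / (cmod z - 1) : R).
  apply: cvgMl; apply: cvg_expr.
  by rewrite ger0_norm ?invr_ge0 ?cmod_ge0// invf_lt1.
rewrite mul0r in cz; move/cvgr_le: cz => /(_ _ d0)[N _ /(_ N (leqnn N)) /= hN].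
exists (- z^-1 *: \poly_(k < N) z^-1 ^+ k) => t.
rewrite hornerZ horner_poly.
under eq_bigr do rewrite -exprMn mulrC.
have wz : expi t != z by apply: contraTneq z1 => <-; rewrite cmod_expi ltxx.
rewrite geometric_expansion// cmodM cmodX cmodM cmodV cmod_expi mul1r.
apply: le_trans hN; rewrite ler_wpM2l ?exprn_ge0 ?invr_ge0 ?cmod_ge0//.
rewrite cmodV lef_pV2 ?posrE ?subr_gt0//.
- by have := cmodB_ge z (expi t); rewrite cmod_expi cmodBC.
- by rewrite lt_neqAle eq_sym cmod_eq0 subr_eq0 wz cmod_ge0.
Qed.

(** All roots lie outside the closed disc, so the inverse is a constant times a product of factors
    (w - z)^-1 with |z| > 1, each a geometric series in w/z that converges uniformly on |w| = 1. *)
Lemma disc_algebra_inv_poly P (c : R) : 0 < c ->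
  (forall z, cmod z <= 1 -> c <= cmod P.[z]) ->
  disc_algebra (fun t => P.[expi t]^-1).
Proof.
move=> c0 Pc; have [rs PE] := closed_field_poly_normal P.
have rs1 z : z \in rs -> 1 < cmod z.
  move=> zrs; rewrite ltNge; apply/negP => /Pc.
  have -> : P.[z] = 0.
    apply/rootP; rewrite PE; apply/rootP; rewrite hornerZ.
    have /rootP -> : root (\prod_(z <- rs) ('X - z%:P)) z by rewrite root_prod_XsubC.
    by rewrite mulr0.
  by rewrite cmod0 leNgt c0.
rewrite (_ : (fun t => _) = (fun t => (lead_coef P)^-1 *
    \prod_(z <- rs) (expi t - z)^-1)); last first.
  apply/funext => t; rewrite {1}PE hornerZ horner_prod invfM prodfV.
  by congr (_ * _^-1); apply: eq_bigr => z _; rewrite hornerXsubC.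
apply: disc_algebraM; first exact: disc_algebra_cst.
elim: rs rs1 {PE} => [|z rs IH] rs1.
  by under eq_fun do rewrite big_nil; exact: disc_algebra_cst.
under eq_fun do rewrite big_cons; apply: disc_algebraM.
  by apply: disc_algebra_inv_root; rewrite rs1// mem_head.
by apply: IH => x xrs; rewrite rs1// in_cons xrs orbT.
Qed.

Lemma disc_algebra_fourier g (n : int) : Bd g -> disc_algebra g -> n < 0 ->
  fourier g n = 0.
Proof.
move=> bg ag n0; apply: (@cmod_small_eq0 _ _ 2) => d d0.
have [Q hQ] := ag d d0; have bQ := Bd_poly_expi Q.
have -> : fourier g n = fourier (fun t => g t - Q.[expi t]) n.
  rewrite fourierB// fourier_poly; case: n n0 => // n _.
  by rewrite subr0.
have bB := BdB bg bQ.
apply: (le_trans (cmod_cmean_le _)); first exact/BdM/Bd_expiN.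
rewrite ler_wpM2l// -[leRHS]rmean_cst; apply: rmean_le.
- exact/Bd_cmod/BdM/Bd_expiN.
- exact: rbd_cst.
- by apply: ae_on_all => t _; rewrite cmodM cmod_expi mulr1.
Qed.

(* Agrees with [1 / f] wherever [c <= |f|]; the truncation of the denominator
   makes measurability and boundedness automatic. *)
Definition binv (c : R) f : fn R := fun t =>
  conjc (f t) * ((Num.max (c ^+ 2) (cmod (f t) ^+ 2))^-1)%:C%C.

Lemma binvE c f t : 0 < c -> c <= cmod (f t) -> binv c f t = (f t)^-1.
Proof.
move=> c0 cf; have f0 : 0 < cmod (f t) := lt_le_trans c0 cf.
have fn0 : f t != 0 by rewrite -cmod_eq0 gt_eqF.
rewrite /binv max_r; last by rewrite lerXn2r ?nnegrE ?cmod_ge0// ltW.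
apply: (mulfI fn0); rewrite mulrA mulcJ divff// -rmorphM divff ?rmorph1//.
by rewrite gt_eqF// exprn_gt0.
Qed.

Lemma Bd_binv c f : 0 < c -> Bd f -> Bd (binv c f).
Proof.
move=> c0 bf; apply: BdM; first exact: (Bd_conj bf).
have c2 : 0 < c ^+ 2 by rewrite exprn_gt0.
apply: rbd_Bd; split; last first.
  exists (c ^+ 2)^-1; apply: ae_on_all => t _.
  have mx : c ^+ 2 <= Num.max (c ^+ 2) (cmod (f t) ^+ 2) by rewrite le_max lexx.
  rewrite ger0_norm ?invr_ge0 ?(le_trans _ mx) ?(ltW c2)//.
  by rewrite lef_pV2 ?posrE// (lt_le_trans c2).
(* The inverse is rewritten as the real power -1 to obtain its measurability from that of [powR]. *)
rewrite (_ : (fun t => _) =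
    (fun t => Num.max (c ^+ 2) (cmod (f t) ^+ 2) `^ (-1))); last first.
  by apply/funext => t; rewrite powR_inv1// le_max (ltW c2).
have mm : measurable_fun T (fun t => Num.max (c ^+ 2) (cmod (f t) ^+ 2)).
  apply: measurable_maxr => //; apply: measurable_funX.
  exact: (measurable_cmod bf.1).
exact: (measurableT_comp (@measurable_powR R (-1)) mm).
Qed.

Lemma rmean_eq0 (h : R -> R) : rbd h -> (forall t, 0 <= h t) -> rmean h = 0 ->
  ae_on (fun t => h t = 0).
Proof.
move=> bh h0 /eqP; rewrite /rmean mulf_eq0 invr_eq0 gt_eqF ?mulr_gt0 ?pi_gt0//=.
move=> /eqP ih; have mT : measurable (T : set (measurableTypeR R)) by exact: measurable_T.
have ih' := integrable_fin_num mT (rbd_integrable bh).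
have mh : measurable_fun (T : set (measurableTypeR R)) (EFin \o h).
  by apply/measurable_EFinP; have [] := bh.
have := (ae_eq_integral_abs mu mT mh).1; 
under eq_integral do rewrite /= ger0_norm//.
rewrite -[X in X = _]fineK// -[fine _]/(Rintegral mu T h) ih => /(_ erefl).
move=> k; apply: (@ae_onS _ (fun t => (h t)%:E = 0%E) _ _ k) => t _ [].
exact.
Qed.

(** On T the deficit max(0, c - |f|) is at most |f - P| for each of the polynomials [P], so its mean
    square is 0. *)
Lemma cmod_lbound_limit f (c : R) : 0 < c -> Bd f ->
  (forall d : R, 0 < d -> exists2 P, (forall z, cmod z <= 1 -> c <= cmod P.[z]) &
    sqn (fun t => f t - P.[expi t]) <= d) ->
  ae_on (fun t => c <= cmod (f t)).
Proof.
move=> c0 bf fP; pose h t := Num.max 0 (c - cmod (f t)) ^+ 2.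
have bm : rbd (fun t => Num.max 0 (c - cmod (f t))).
  split.
    apply: measurable_maxr => //; apply: measurable_funB => //.
    exact: (measurable_cmod bf.1).
  exists c; apply: ae_on_all => t _.
  rewrite ger0_norm ?le_max ?lexx// ge_max (ltW c0)/= gerBl cmod_ge0//.
have bh : rbd h by exact: (rbdM bm bm).
have h0 t : 0 <= h t by exact: sqr_ge0.
have : rmean h = 0.
  apply/le_anti/andP; split; last first.
    by apply: rmean_ge0 => //; exact: ae_on_all.
  apply/ler_addgt0Pr => d d0; rewrite add0r; have [P Pc fPd] := fP _ d0.
  apply: (le_trans _ fPd); have bP := Bd_poly_expi P.
  apply: rmean_le => //; first exact/Bd_sqr/BdB.
  apply: ae_on_all => t _; rewrite lerXn2r ?nnegrE ?cmod_ge0 ?le_max ?lexx//.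
  rewrite ge_max cmod_ge0/=; have := Pc (expi t); rewrite cmod_expi => /(_ (lexx _)).
  have := cmodB_ge P.[expi t] (f t); rewrite cmodBC; lra.
move/(rmean_eq0 bh h0); apply: ae_onS => t _ /eqP.
rewrite sqrf_eq0 => /eqP ht; rewrite -subr_le0 -ht le_max lexx orbT//.
Qed.

(** Since 1/f - 1/p = (p - f)/(f p) is bounded by c^-2 |f - p|, the coefficients of 1/f are limits
    of those of 1/p for the polynomials p, and these vanish at negative indices. *)
Lemma Hb_inv f (c0 c : R) : Hb f -> 0 < c -> c < c0 ->
  (forall z, cmod z < 1 -> c0 <= cmod (extD f z)) ->
  ae_on (fun t => c <= cmod (f t)) /\ Hb (binv c f).
Proof.
move=> [bf hf] c_gt0 cc0 fc0.
have fP := nonvanishing_poly_appr bf hf cc0 fc0.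
have fc := cmod_lbound_limit c_gt0 bf fP.
have bi := Bd_binv c_gt0 bf.
split=> //; apply: Hb_coef => // n n0.
apply: (@cmod_small_eq0 _ _ (2 * (c^-1 * c^-1))) => d d0.
have [P Pc fPd] := fP (d ^+ 2) (exprn_gt0 2 d0).
have bP := Bd_poly_expi P; pose p (t : R) := P.[expi t].
have pc t : c <= cmod (p t) by apply: Pc; rewrite cmod_expi.
have piE : binv c p = (fun t => (p t)^-1).
  by apply/funext => t; rewrite binvE.
have bpi : Bd (binv c p) by exact: Bd_binv.
have -> : fourier (binv c f) n = fourier (fun t => binv c f t - binv c p t) n.
  rewrite fourierB// [X in _ - X]disc_algebra_fourier ?subr0//.
  by rewrite piE; exact: (disc_algebra_inv_poly c_gt0 Pc).
have bQ : Bd (fun t => - (binv c f t * binv c p t * expi (- (n%:~R * t)))).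
  exact/BdN/BdM/Bd_expiN/BdM.
rewrite /fourier.
have -> : cmean (fun t => (binv c f t - binv c p t) * expi (- (n%:~R * t))) =
    cmean (fun t => (f t - p t) *
      - (binv c f t * binv c p t * expi (- (n%:~R * t)))).
  apply: cmean_ae.
  - exact: (BdM (BdB bi bpi) (Bd_expiN _ n)).1.
  - exact: (BdM (BdB bf bP) bQ).1.
  apply: ae_onS fc => t _ ct; rewrite !binvE//.
  have f0 : f t != 0 by rewrite -cmod_eq0 gt_eqF// (lt_le_trans c_gt0).
  have p0 : p t != 0 by rewrite -cmod_eq0 gt_eqF// (lt_le_trans c_gt0).
  by field; rewrite f0 p0.
rewrite -mulrA; apply: cmean_small => //.
- exact: BdB.
- by rewrite mulr_ge0 ?invr_ge0 ?ltW.
- apply: ae_onS fc => t _ ct.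
  rewrite !binvE// cmodN !cmodM cmod_expi mulr1 !cmodV.
  by rewrite ler_pM ?invr_ge0 ?cmod_ge0// lef_pV2 ?posrE// (lt_le_trans c_gt0).
Qed.

End Inverse.

(** * The linear system of a factorization *)

Section Factorization.
Variable R : realType.
Local Notation C := (R[i]).
Implicit Types (a b ap bp am bm : fn R).

Lemma conjcB (x y : C) : conjc (x - y) = conjc x - conjc y.
Proof. exact: raddfB. Qed.

Definition unit_pair a b := ae_on (fun t => cmod (a t) ^+ 2 + cmod (b t) ^+ 2 = 1).

Lemma unit_pair_Bd a b : measurable_fn a -> measurable_fn b -> unit_pair a b ->
  Bd a /\ Bd b.
Proof.
move=> ma mb ab; split; split=> //; exists 1; apply: ae_onS ab => t _ h.
- rewrite -(@ler_pXn2r _ 2)// ?nnegrE ?cmod_ge0// expr1n -h.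
  by rewrite lerDl sqr_ge0.
- rewrite -(@ler_pXn2r _ 2)// ?nnegrE ?cmod_ge0// expr1n -h.
  by rewrite lerDr sqr_ge0.
Qed.

Lemma Lset_facts a b : Lset (a, b) ->
  [/\ Bd a, Bd b, unit_pair a b, Hb (star a) &
      exists2 al : R, 0 < al & cmean (star a) = al%:C%C].
Proof.
move=> [ma [mb [ab [ha a0]]]].
have ab' : unit_pair a b.
  apply: ae_onS ab => t _; rewrite /star !mulcJ -rmorphD => /(congr1 (@complex.Re R)).
  by [].
have [ba bb] := unit_pair_Bd ma mb ab'.
have bsa := Bd_conj ba; split=> //.
move: a0; rewrite -[X in 0 < X]/(conjc (extD (star a) 0)) extD0//.
case: (cmean _) => x y /=.
(* In the order of [R[i]], being positive includes being real. *)
rewrite ltcE /= oppr_eq0 => /andP[/eqP -> x0]; exists x => //.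
Qed.

Lemma infDstar_le a (c0 : R) : c0 <= infDstar a ->
  forall z, cmod z < 1 -> c0 <= cmod (extD (star a) z).
Proof.
move=> h z z1; apply: (le_trans h).
have lb (w : option C) : Dstar w -> infDstar a <= cmod (extDstar a w).
  move=> Dw; apply: ge_inf; last by exists w.
  by exists 0 => _ [v _ <-]; exact: cmod_ge0.
(* Here 0^-1 is 0, so the centre has to be matched with oo by hand. *)
have [->|z0] := eqVneq z 0.
  have := lb None I.
  by rewrite -[extDstar _ _]/(conjc (extD (star a) 0)) cmod_conj.
have := lb (Some (conjc z)^-1).
rewrite -[extDstar _ _]/(conjc (extD (star a) (conjc (conjc z)^-1)^-1)).
rewrite conjc_inv conjcK invrK cmod_conj.
apply; rewrite /Dstar /= cmodV cmod_conj invf_gt1//.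
by rewrite lt_neqAle eq_sym cmod_eq0 z0 cmod_ge0.
Qed.

(* For a factorization [(a, b) = (am, bm) (ap, bp)], the pair
   [al (ap, bp)] with [al = ap(oo)] solves the linear system
   [ap + (b/a)^* bp = E], [(b/a) ap - bp = e^*] in which [E] and [e] are in
   H^2(D) with means 1 and 0. *)
Definition factor_data (ap bp r : fn R) (al : R) := exists E e : fn R,
  [/\ 0 < al, Hb (star ap), Hb bp, unit_pair ap bp &
   [/\ Hb E, Hb e, cmean E = 1, cmean e = 0 & ae_on (fun t =>
     E t = al%:C%C * (ap t + conjc (r t) * bp t) /\
     e t = al%:C%C * (conjc (r t) * conjc (ap t) - conjc (bp t)))]].

(** The inverse of the unit pair (ap, bp) is (ap^*, - bp). Multiplying by it on the right expresses
    am^* and bm^* through a, b, ap, bp; dividing by a^* keeps them in H^oo and yields E and e up to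
    the factor [al]. *)
Lemma factorization_data (eps : R) a b am bm ap bp : 0 < eps ->
  Beps eps (a, b) -> H0star (am, bm) -> Hset (ap, bp) ->
  pair_ae_eq (a, b) (pmul (am, bm) (ap, bp)) ->
  [/\ (Num.sqrt 2)^-1 + eps <= 1, Bd a, Bd b, unit_pair a b &
  ae_on (fun t => (Num.sqrt 2)^-1 <= cmod (a t)) /\
  exists r al, [/\ Bd r, ae_on (fun t => r t = b t / a t) & factor_data ap bp r al]].
Proof.
move=> eps0 [[La _] /= infa] [Lm [[[_ /= hbm] _] bm0']] [[Lp /= hbp] _] pE.
have [ba bb uab Hsa [aoo aoo0 aooE]] := Lset_facts La.
have [bam bbm uabm Hsam [moo moo0 mooE]] := Lset_facts Lm.
have [bap bbp uabp Hsap [al al0 alE]] := Lset_facts Lp.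
have bm0 : extD (star bm) 0 = 0 := bm0'.
set c := (Num.sqrt 2)^-1 in infa *.
have c_gt0 : 0 < c by rewrite invr_gt0 sqrtr_gt0.
have disc := infDstar_le infa.
(* [eps] supplies the gap that [Hb_inv] needs between the bound on the disc and the bound on T. *)
have cc0 : c < c + eps by rewrite ltrDl.
have [ca Hh] := Hb_inv Hsa c_gt0 cc0 disc; set h := binv c (star a) in Hh.
have ca' : ae_on (fun t => c <= cmod (a t)).
  by apply: ae_onS ca => t _; rewrite /star cmod_conj.
have Hsbm : Hb (star bm) by split=> //; exact: Bd_conj.
have Hbp : Hb bp by [].
have hE : ae_on (fun t => star a t * h t = 1).
  apply: ae_onS ca => t _ ct; rewrite /h binvE// divff// -cmod_eq0 gt_eqF//.
  exact: lt_le_trans ct.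
have fE : ae_on (fun t => star a t = star am t * star ap t - star bm t * bp t).
  apply: ae_onS pE => t _ /= [e1 _].
  by rewrite /star e1 /star conjcB !conjcM conjcK.
(* Evaluation of a^* = am^* ap^* - bm^* bp at 0, where bm^* vanishes. This relation normalizes the
   mean of E to 1. *)
have aE : aoo%:C%C = moo%:C%C * al%:C%C.
  rewrite -aooE -mooE -alE -(Hb_mean Hsam Hsap).
  rewrite (@cmean_ae _ _ (fun t => star am t * star ap t - star bm t * bp t))//.
  - rewrite cmeanB; [|exact: (HbM Hsam Hsap).1|exact: (HbM Hsbm Hbp).1].
    by rewrite (Hb_mean Hsbm Hbp) -(extD0 Hsbm.1) bm0 mul0r subr0.
  - exact: Hsa.1.1.
  - exact: (HbB (HbM Hsam Hsap) (HbM Hsbm Hbp)).1.1.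
have mh : aoo%:C%C * cmean h = 1.
  rewrite -aooE -Hb_mean// -(cmean_cst (1 : C)); apply: cmean_ae => //.
  exact: (HbM Hsa Hh).1.1.
split=> //.
  (* The bound at the centre reads 2^{-1/2} + eps <= a(oo), and a(oo) is a mean of values of modulus
     at most 1. *)
  have := disc 0; rewrite cmod0 ltr01 extD0 ?aooE; last exact: Hsa.1.
  move=> /(_ erefl) /le_trans; apply.
  rewrite cmod_real gtr0_norm// -[aoo]/(complex.Re aoo%:C%C) -aooE.
  rewrite (le_trans (ler_norm _))// (le_trans (Re_cmean_le Hsa.1))//.
  rewrite -[leRHS]rmean_cst; apply: rmean_le; [exact: (Bd_cmod Hsa.1)|exact: rbd_cst|].
  apply: ae_onS uab => t _ e1; rewrite /star cmod_conj.
  by rewrite -(@ler_pXn2r _ 2)// ?nnegrE ?cmod_ge0// expr1n -e1 lerDl sqr_ge0.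
split=> //; exists (fun t => star h t * b t), al.
have hV : ae_on (fun t => h t = (conjc (a t))^-1).
  by apply: ae_onS ca => t _ ct; rewrite /h binvE.
split.
- exact/BdM/bb/Bd_conj/Hh.1.
- by apply: ae_onS hV => t _ ht; rewrite /star ht conjc_inv conjcK mulrC.
exists (fun t => al%:C%C * (star am t * h t)), (fun t => al%:C%C * (star bm t * h t)).
split=> //; split.
- exact/HbZ/HbM.
- exact/HbZ/HbM.
- rewrite cmeanZ; last exact: (HbM Hsam Hh).1.
  by rewrite (Hb_mean Hsam Hh) mooE mulrA [al%:C%C * _]mulrC -aE.
- rewrite cmeanZ; last exact: (HbM Hsbm Hh).1.
  by rewrite (Hb_mean Hsbm Hh) -(extD0 Hsbm.1) bm0 mul0r mulr0.
have up : ae_on (fun t => ap t * conjc (ap t) + bp t * conjc (bp t) = 1).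
  by apply: ae_onS uabp => t _ e1; rewrite !mulcJ -rmorphD e1.
have key : ae_on (fun t => star am t = star a t * ap t + conjc (b t) * bp t /\
    star bm t = conjc (b t) * conjc (ap t) - star a t * conjc (bp t)).
  apply: ae_onS2 pE up => t _ /= [e2 e3] e1.
  rewrite /star e2 e3 /star conjcB conjcD !conjcM !conjcK; split.
  - transitivity (conjc (am t) * (ap t * conjc (ap t) + bp t * conjc (bp t))).
      by rewrite e1 mulr1.
    by ring.
  - transitivity (conjc (bm t) * (ap t * conjc (ap t) + bp t * conjc (bp t))).
      by rewrite e1 mulr1.
    by ring.
apply: ae_onS2 key hE => t _ [-> ->] ht.
rewrite conjcM /star conjcK; split; congr (_ * _).
- transitivity ((star a t * h t) * ap t + h t * conjc (b t) * bp t).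
    by rewrite /star; ring.
  by rewrite ht mul1r.
- transitivity (h t * conjc (b t) * conjc (ap t) - (star a t * h t) * conjc (bp t)).
    by rewrite /star; ring.
  by rewrite ht mul1r.
Qed.

End Factorization.

(** * Stability of the linear system *)

Section Stability.
Variable R : realType.
Local Notation C := (R[i]).
Implicit Types (a b r : fn R).

Lemma Bd_star_inv (f : fn R) : Bd (star f) -> Bd f.
Proof.
move/Bd_conj; rewrite (_ : star (star f) = f)//.
by apply/funext => t; rewrite /star conjcK.
Qed.

Lemma cauchy_schwarz2 (x1 x2 y1 y2 : R) :
  (x1 * y1 + x2 * y2) ^+ 2 <= (x1 ^+ 2 + x2 ^+ 2) * (y1 ^+ 2 + y2 ^+ 2).
Proof.
rewrite -subr_ge0 [leRHS](_ : _ = (x1 * y2 - x2 * y1) ^+ 2) ?sqr_ge0//.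
by ring.
Qed.

Lemma cmod_cross (x1 x2 y1 y2 : C) : cmod (x1 * y1 - x2 * y2) ^+ 2 <=
  (cmod x1 ^+ 2 + cmod x2 ^+ 2) * (cmod y1 ^+ 2 + cmod y2 ^+ 2).
Proof.
apply: le_trans (cauchy_schwarz2 _ _ _ _).
rewrite lerXn2r ?nnegrE ?cmod_ge0 ?addr_ge0 ?mulr_ge0 ?cmod_ge0//.
by rewrite (le_trans (cmodD _ _))// cmodN !cmodM.
Qed.

(* The antisymmetric off-diagonal part of the linear system cancels in the
   energy identity, so only the difference of the coefficients remains. *)
Lemma factor_energy ap bp r al ap' bp' r' al' :
  Bd r -> Bd r' -> factor_data ap bp r al -> factor_data ap' bp' r' al' ->
  sqn (fun t => al%:C%C * ap t - al'%:C%C * ap' t) +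
  sqn (fun t => al%:C%C * bp t - al'%:C%C * bp' t) <=
  al' ^+ 2 * sqn (fun t => r t - r' t).
Proof.
move=> br br' [E [e [al0 Hap Hbp up [HE He E1 e0 eqs]]]].
move=> [E' [e' [al0' Hap' Hbp' up' [HE' He' E1' e0' eqs']]]].
set u := fun t => _ - _; set v := fun t => al%:C%C * bp t - _.
pose del t := r t - r' t.
have Hsu : Hb (star u).
  rewrite (_ : star u = fun t => al%:C%C * star ap t - al'%:C%C * star ap' t).
    by apply: HbB; exact: HbZ.
  apply/funext => t; rewrite /star /u conjcB !conjcM.
  by rewrite /= !oppr0.
have Hv : Hb v by apply: HbB; exact: HbZ.
have bu : Bd u := Bd_star_inv Hsu.1.
have bdel : Bd del by exact: BdB.
(* What the change of coefficient leaves over, through r^* f - r'^* f' = r^* (f - f') + (r - r')^*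
   f'. *)
pose w t := al'%:C%C * (bp' t * conjc (u t) - conjc (ap' t) * v t).
have bw : Bd w.
  apply: BdM; first exact: Bd_cst.
  apply: BdB; apply: BdM; [exact: Hbp'.1|exact: Hsu.1|exact: Hap'.1|exact: Hv.1].
have bdw : Bd (fun t => star del t * w t) by apply: BdM => //; exact: Bd_conj.
have bF : Bd (fun t => (E t - E' t) * star u t - (e t - e' t) * v t).
  exact: (HbB (HbM (HbB HE HE') Hsu) (HbM (HbB He He') Hv)).1.
(* All four factors are in H^oo, and [E - E'] and [e - e'] have mean 0 because the means of E and e
   do not depend on the factorization. *)
have zero : cmean (fun t => (E t - E' t) * star u t - (e t - e' t) * v t) = 0.
  have hEE := HbB HE HE'; have hee := HbB He He'.
  rewrite cmeanB; [|exact: (HbM hEE Hsu).1|exact: (HbM hee Hv).1].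
  rewrite (Hb_mean hEE Hsu) (Hb_mean hee Hv).
  rewrite (cmeanB HE.1 HE'.1) (cmeanB He.1 He'.1).
  by rewrite E1 E1' e0 e0' !subrr !mul0r subr0.
pose G t := u t * star u t + v t * star v t.
have bG : Bd G.
  by apply: BdD; apply: BdM => //; [exact: Hsu.1|exact: Hv.1|exact: Bd_conj Hv.1].
have FE : ae_on (fun t => (E t - E' t) * star u t - (e t - e' t) * v t =
    G t + star del t * w t).
  apply: ae_onS2 eqs eqs' => t _ [-> ->] [-> ->].
  rewrite /G /w /star /del /u /v !conjcB !conjcM.
  rewrite -[conjc al%:C%C]/(conjc (real_complex R al)) !conjc_real.
  ring.
have Gw : cmean G + cmean (fun t => star del t * w t) = 0.
  rewrite -cmeanD// -zero; apply/esym/cmean_ae => //; first exact: bF.1.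
  exact: (BdD bG bdw).1.
have GE : complex.Re (cmean G) = sqn u + sqn v.
  rewrite /sqn -rmeanD; [|exact: Bd_sqr|exact: (Bd_sqr Hv.1)].
  rewrite cmeanE /=; congr rmean; apply/funext => t.
  by rewrite /G /star !mulcJ.
have {Gw}: sqn u + sqn v = - complex.Re (cmean (fun t => star del t * w t)).
  rewrite -GE; move/(congr1 (@complex.Re R)): Gw; rewrite ReD /= => /eqP.
  by rewrite addr_eq0 => /eqP.
(* Cauchy-Schwarz against the unit pair (ap', bp') gives |w|^2 <= al'^2 (|u|^2 + |v|^2). The half of
   the energy produced by the arithmetic-geometric inequality is absorbed on the left. *)
have bound : rmean (fun t => cmod (star del t * w t)) <=
    2^-1 * (al' ^+ 2 * sqn del + (sqn u + sqn v)).
  have [q1 q2 q3] : [/\ rbd (fun t => cmod (del t) ^+ 2),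
    rbd (fun t => cmod (u t) ^+ 2) & rbd (fun t => cmod (v t) ^+ 2)].
    by split; [exact: Bd_sqr|exact: Bd_sqr|exact: (Bd_sqr Hv.1)].
  have q1' := rbdM (rbd_cst (al' ^+ 2)) q1.
  rewrite /sqn -(rmeanZ _ q1) -(rmeanD q2 q3) -(rmeanD q1' (rbdD q2 q3)).
  rewrite -(rmeanZ _ (rbdD q1' (rbdD q2 q3))).
  apply: rmean_le; [exact: Bd_cmod| |].
    exact: (rbdM (rbd_cst _) (rbdD q1' (rbdD q2 q3))).
  apply: ae_onS up' => t _ e1; rewrite !cmodM /star cmod_conj cmod_real gtr0_norm//.
  have := cmod_cross (bp' t) (conjc (ap' t)) (conjc (u t)) (v t).
  rewrite !cmod_conj [cmod (bp' t) ^+ 2 + _]addrC e1 mul1r.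
  set y := cmod (_ - _); set x := cmod (del t) => hy.
  have := sqr_ge0 (al' * x - y); nra.
move=> eqn; have := Re_cmean_le bdw.
have := ler_norm (- complex.Re (cmean (fun t => star del t * w t))).
rewrite normrN; lra.
Qed.

(** Of the two upper bounds, the one with the smaller scale suffices, since min(x, y)^2 <= x y. *)
Lemma le_of_scaled_bounds (x y N D S : R) : 0 < x -> 0 < y -> 0 <= D ->
  x * y * N <= S -> S <= y ^+ 2 * D -> S <= x ^+ 2 * D -> N <= D.
Proof.
move=> x0 y0 D0 low h1 h2.
have k1 : x * N <= y * D.
  by rewrite -(ler_pM2l y0) !mulrA [y * x]mulrC -expr2 (le_trans low).
have k2 : y * N <= x * D.
  by rewrite -(ler_pM2l x0) !mulrA -expr2 (le_trans low).
have [le_xy|le_yx] := leP x y.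
- by rewrite -(ler_pM2l y0) (le_trans k2)// ler_wpM2r.
- by rewrite -(ler_pM2l x0) (le_trans k1)// ler_wpM2r// ltW.
Qed.

Lemma factor_dist ap bp r al ap' bp' r' al' :
  Bd r -> Bd r' -> factor_data ap bp r al -> factor_data ap' bp' r' al' ->
  sqn (fun t => ap t - ap' t) + sqn (fun t => bp t - bp' t) <=
  sqn (fun t => r t - r' t).
Proof.
move=> br br' fd fd'; have h1 := factor_energy br br' fd fd'.
have h2 := factor_energy br' br fd' fd.
have symm (f g : fn R) (x y : C) : sqn (fun t => y * g t - x * f t) =
    sqn (fun t => x * f t - y * g t).
  by rewrite /sqn; congr rmean; apply/funext => t; rewrite cmodBC.
have symm1 : sqn (fun t => r' t - r t) = sqn (fun t => r t - r' t).
  by rewrite /sqn; congr rmean; apply/funext => t; rewrite cmodBC.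
rewrite symm [X in _ + X <= _]symm symm1 in h2.
case: fd => E [e [al0 Hap Hbp up _]]; case: fd' => E' [e' [al0' Hap' Hbp' up' _]].
have [Bap Bap'] : Bd ap /\ Bd ap'.
  by split; apply: Bd_star_inv; [exact: Hap.1|exact: Hap'.1].
have [Bbp Bbp'] := (Hbp.1, Hbp'.1).
(* For unit vectors the difference of the two sides is (al - al')^2. *)
have low : al * al' * (sqn (fun t => ap t - ap' t) + sqn (fun t => bp t - bp' t))
  <= sqn (fun t => al%:C%C * ap t - al'%:C%C * ap' t) +
     sqn (fun t => al%:C%C * bp t - al'%:C%C * bp' t).
  have bZ (x : R) (f : fn R) : Bd f -> Bd (fun t => x%:C%C * f t).
    by move=> bf; apply: BdM => //; exact: Bd_cst.
  have q1 := Bd_sqr (BdB Bap Bap'); have q2 := Bd_sqr (BdB Bbp Bbp').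
  have q3 := Bd_sqr (BdB (bZ al _ Bap) (bZ al' _ Bap')).
  have q4 := Bd_sqr (BdB (bZ al _ Bbp) (bZ al' _ Bbp')).
  rewrite /sqn -(rmeanD q1 q2) -(rmeanD q3 q4) -(rmeanZ _ (rbdD q1 q2)).
  apply: rmean_le; [exact: (rbdM (rbd_cst _) (rbdD q1 q2))|exact: rbdD|].
  apply: ae_onS2 up up' => t _; rewrite !sqr_cmod.
  case: (ap t) => a1 a2; case: (bp t) => b1 b2.
  case: (ap' t) => c1 c2; case: (bp' t) => d1 d2 /=.
  rewrite !mul0r !subr0 !addr0 => e1 e2.
  rewrite -subr_ge0 [leRHS](_ : _ = (al - al') ^+ 2 +
    al * (al - al') * (a1 ^+ 2 + a2 ^+ 2 + (b1 ^+ 2 + b2 ^+ 2) - 1) -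
    al' * (al - al') * (c1 ^+ 2 + c2 ^+ 2 + (d1 ^+ 2 + d2 ^+ 2) - 1)); last by ring.
  by rewrite e1 e2 subrr !mulr0 subr0 addr0 sqr_ge0.
exact: (le_of_scaled_bounds al0 al0' (sqn_ge0 _) low h1 h2).
Qed.

(** The numerator of b/a - b'/a' is (b - b') a' - (a - a') b', to which Cauchy-Schwarz with the unit
    pair (a', b') applies. The factor 4 comes from |a a'|^2 >= 1/4. *)
Lemma quotient_dist a b r a' b' r' : Bd a -> Bd b -> Bd a' -> Bd b' ->
  Bd r -> Bd r' -> unit_pair a' b' ->
  ae_on (fun t => (Num.sqrt 2)^-1 <= cmod (a t)) ->
  ae_on (fun t => (Num.sqrt 2)^-1 <= cmod (a' t)) ->
  ae_on (fun t => r t = b t / a t) -> ae_on (fun t => r' t = b' t / a' t) ->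
  sqn (fun t => r t - r' t) <=
  4 * (sqn (fun t => a t - a' t) + sqn (fun t => b t - b' t)).
Proof.
move=> ba bb ba' bb' br br' u' ca ca' rE rE'.
have q1 := Bd_sqr (BdB ba ba'); have q2 := Bd_sqr (BdB bb bb').
rewrite /sqn -(rmeanD q1 q2) -(rmeanZ _ (rbdD q1 q2)).
apply: rmean_le; [exact/Bd_sqr/BdB|exact: (rbdM (rbd_cst _) (rbdD q1 q2))|].
have rr : ae_on (fun t => r t - r' t = b t / a t - b' t / a' t).
  by apply: ae_onS2 rE rE' => t _ -> ->.
have cc : ae_on (fun t => 2^-1 <= cmod (a t) ^+ 2 /\ 2^-1 <= cmod (a' t) ^+ 2).
  have c2 (x : R) : (Num.sqrt 2)^-1 <= x -> 2^-1 <= x ^+ 2.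
    have s0 : 0 <= (Num.sqrt 2)^-1 :> R by rewrite invr_ge0 sqrtr_ge0.
    move=> h; have -> : 2^-1 = (Num.sqrt 2)^-1 ^+ 2 :> R.
      by rewrite exprVn sqr_sqrtr.
    by apply: lerXn2r => //; rewrite nnegrE// (le_trans s0).
  by apply: ae_onS2 ca ca' => t _ /c2 h1 /c2 h2.
have rc : ae_on (fun t => r t - r' t = b t / a t - b' t / a' t /\
    (2^-1 <= cmod (a t) ^+ 2 /\ 2^-1 <= cmod (a' t) ^+ 2)).
  by apply: ae_onS2 rr cc.
apply: ae_onS2 rc u' => t _ [-> [h1 h2]] e1.
have nz (z : C) : 2^-1 <= cmod z ^+ 2 -> z != 0.
  move=> h; apply/eqP => z0; move: h; rewrite z0 cmod0 expr0n /=.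
  by rewrite leNgt invr_gt0 ltr0n.
have a0 := nz _ h1; have a0' := nz _ h2.
have -> : b t / a t - b' t / a' t =
    ((b t - b' t) * a' t - (a t - a' t) * b' t) / (a t * a' t).
  by field; rewrite a0 a0'.
rewrite cmodM cmodV cmodM exprMn exprVn exprMn.
have := cmod_cross (b t - b' t) (a t - a' t) (a' t) (b' t).
rewrite e1 mulr1 => hc.
have p0 : 0 < cmod (a t) ^+ 2 * cmod (a' t) ^+ 2.
  have h0 : 0 < 2^-1 :> R by rewrite invr_gt0.
  by rewrite mulr_gt0// ?(lt_le_trans h0 h1)// (lt_le_trans h0 h2).
rewrite ler_pdivrMr//; apply: (le_trans hc).
rewrite [leLHS]addrC; set S := cmod (a t - a' t) ^+ 2 + _.
have S0 : 0 <= S by rewrite addr_ge0 ?sqr_ge0.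
have p4 : 1 <= 4 * (cmod (a t) ^+ 2 * cmod (a' t) ^+ 2).
  have : 2^-1 * 2^-1 <= cmod (a t) ^+ 2 * cmod (a' t) ^+ 2 :> R.
    by rewrite ler_pM// invr_ge0.
  lra.
rewrite mulrAC -[leLHS]mul1r.
by rewrite ler_wpM2r.
Qed.

(** From 2^{-1/2} >= 7/10 one gets eps <= 3/10, and 27 <= 36 gives eta <= 3. So eta eps <= 1, its
    negative power is at least 1, and the prefactor is at least 4. *)
Lemma lipschitz_constant_ge2 (eps : R) : 0 < eps -> (Num.sqrt 2)^-1 + eps <= 1 ->
  2 <= (2 `^ (5 / 2) + 4) * (3 `^ (3 / 2) / 2 * eps) `^ (- (3 / 2)).
Proof.
move=> eps0 eps1; set eta := 3 `^ (3 / 2) / 2.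
have c7 : 7 / 10 <= (Num.sqrt 2)^-1 :> R.
  rewrite -(@ler_pXn2r _ 2)// ?nnegrE ?invr_ge0 ?sqrtr_ge0//.
  by rewrite exprVn sqr_sqrtr//; lra.
have y6 : 3 `^ (3 / 2) <= 6 :> R.
  rewrite -(@ler_pXn2r _ 2)// ?nnegrE ?powR_ge0//.
  rewrite -powR_mulrn ?powR_ge0// -powRrM.
  rewrite (_ : 3 / 2 * 2%:R = 3%:R); last by field.
  by rewrite powR_mulrn//; lra.
have y0 : 0 < 3 `^ (3 / 2) :> R by exact: powR_gt0.
have h0 : 0 < eta * eps by rewrite mulr_gt0// divr_gt0.
have h1 : eta * eps <= 1 by rewrite /eta; nra.
have hp : 1 <= (eta * eps) `^ (- (3 / 2)).
  rewrite powRN invf_ge1 ?powR_gt0//.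
  have r0 : 0 <= 3 / 2 :> R by rewrite divr_ge0.
  have := ge0_ler_powR r0 _ _ h1; rewrite powR1; apply; rewrite nnegrE//.
  exact: ltW.
have := powR_ge0 (2 : R) (5 / 2); nra.
Qed.

End Stability.

Unset Implicit Arguments.

Theorem theorem7p4 (R : realType) (eps : R) (heps : 0 < eps)
    (p pm pp q qm qp : pair R) :
  Beps eps p -> H0star pm -> Hset pp -> pair_ae_eq p (pmul pm pp) ->
  Beps eps q -> H0star qm -> Hset qp -> pair_ae_eq q (pmul qm qp) ->
  let eta : R := 3 `^ (3 / 2) / 2 in
  Hnorm (psub pp qp) <=
    (2 `^ (5 / 2) + 4) * (eta * eps) `^ (- (3 / 2)) * Hnorm (psub p q).
Proof.
case: p pm pp q qm qp => [a b] [am bm] [ap bp] [a' b'] [am' bm'] [ap' bp'].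
move=> Bp mp pp pE Bq mq pq qE; cbv zeta.
have [eps1 ba bb _ [ca [r [al [br rE fd]]]]] := factorization_data heps Bp mp pp pE.
have [_ ba' bb' u' [ca' [r' [al' [br' rE' fd']]]]] :=
  factorization_data heps Bq mq pq qE.
have dist := le_trans (factor_dist br br' fd fd')
  (quotient_dist ba bb ba' bb' br br' u' ca ca' rE rE').
have HnormE (f g : fn R) : Hnorm (f, g) = Num.sqrt (sqn f + sqn g).
  by rewrite /Hnorm !L2normE !sqr_sqrtr ?sqn_ge0.
rewrite /psub /= !HnormE.
set N := sqn _ + sqn _ in dist *; set M := sqn _ + sqn _ in dist *.
apply: (@le_trans _ _ (2 * Num.sqrt M)).
  rewrite (le_trans (ler_wsqrtr dist))// sqrtrM// (_ : 4 = 2 ^+ 2 :> R); last by ring.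
  by rewrite sqrtr_sqr ger0_norm.
by rewrite ler_wpM2r ?sqrtr_ge0// lipschitz_constant_ge2.
Qed.
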